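(* Consider the stochastic block mirror descent (SBMD) method described in the context, run for $N\ge 1$ iterations with stepsizes $\gamma_k>0$ and weights $\theta_k=\gamma_k$ for $k=1,\dots,N$, and block probabilities $p_1,\dots,p_b>0$ with $\sum_{i=1}^b p_i=1$. Let $\bar x_N=\left(\sum_{k=1}^N\gamma_k\right)^{-1}\sum_{k=1}^N\gamma_k x_k$ be its output. Then for every $x\in X$, \[ \mathbb{E}[f(\bar x_N)-f(x)]\le\left(\sum_{k=1}^N\gamma_k\right)^{-1}\left[\sum_{i=1}^b p_i^{-1}V_i(x_1^{(i)},x^{(i)})+\frac12\sum_{k=1}^N\gamma_k^2\sum_{i=1}^b M_i^2\right], \] where the expectation is taken with respect to $\{i_k\}$ and $\{\xi_k\}$.
   Context: Block structure: for $i=1,\dots,b$, $X_i\subseteq\mathbb{R}^{n_i}$ is a nonempty closed convex set, $n=n_1+\dots+n_b$, and $X=X_1\times\cdots\times X_b\subseteq\mathbb{R}^n$. Each $\mathbb{R}^{n_i}$ carries a norm $\|\cdot\|_i$ with dual norm $\|\cdot\|_{i,*}$. The matrices $U_i\in\mathbb{R}^{n\times n_i}$ satisfy $(U_1,\dots,U_b)=I_n$, and $x^{(i)}:=U_i^Tx$ is the $i$-th block of $x$. Problem: $\xi$ is a random vector with support $\Xi\subseteq\mathbb{R}^d$, $F(\cdot,\xi):X\to\mathbb{R}$ is continuous for each $\xi$, and $f(x)=\mathbb{E}[F(x,\xi)]$ is a convex function on $X$. A stochastic oracle returns $G(x,\xi)\in\mathbb{R}^n$ with $\mathbb{E}[G(x,\xi)]=g(x)\in\partial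 f(x)$ for all $x\in X$; write $G_i(x,\xi)=U_i^TG(x,\xi)$ and assume $\mathbb{E}[\|G_i(x,\xi)\|_{i,*}^2]\le M_i^2$ for all $x\in X$, $i=1,\dots,b$. Prox setup: each $\omega_i:X_i\to\mathbb{R}$ is continuously differentiable and 1-strongly convex w.r.t. $\|\cdot\|_i$, i.e. $\langle x-z,\nabla\omega_i(x)-\nabla\omega_i(z)\rangle\ge\|x-z\|_i^2$. Bregman distance: $V_i(z,x)=\omega_i(x)-\omega_i(z)-\langle\nabla\omega_i(z),x-z\rangle$ for $x,z\in X_i$. Prox-mapping: $P_i(v,y,\gamma)=\arg\min_{u\in X_i}\{\langle y,u\rangle+\frac1\gamma V_i(v,u)\}$. SBMD method: given $x_1\in X$, let $\xi_1,\xi_2,\dots$ be i.i.d. copies of $\xi$ and $i_1,i_2,\dots$ i.i.d. random indices with $\mathrm{Prob}(i_k=i)=p_i$, independent of the $\xi_k$. For $k=1,\dots,N$: set $x_{k+1}^{(i_k)}=P_{i_k}(x_k^{(i_k)},G_{i_k}(x_k,\xi_k),\gamma_k)$ and $x_{k+1}^{(i)}=x_k^{(i)}$ for $i\ne i_k$. The output is $\bar x_N=\left(\sum_{k=1}^N\theta_k\right)^{-1}\sum_{k=1}^N\theta_kx_k$. *)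

(* Defs.v *)
From HB Require Import structures.
From mathcomp Require Import all_boot all_order all_algebra.
From mathcomp Require Import all_classical all_reals all_analysis.
Import Order.TTheory GRing.Theory Num.Theory numFieldNormedType.Exports.

Set Implicit Arguments.
Unset Strict Implicit.
Unset Printing Implicit Defensive.

Local Open Scope classical_set_scope.
Local Open Scope ring_scope.

Section Defs.
Variable R : realType.

Definition dotv m (y u : 'rV[R]_m) : R := \sum_(j < m) y ord0 j * u ord0 j.

Definition is_norm m (nrm : 'rV[R]_m -> R) : Prop :=
  [/\ forall u, 0 <= nrm u,
      forall u, nrm u = 0 -> u = 0,
      forall (a : R) u, nrm (a *: u) = `|a| * nrm u &
      forall u v, nrm (u + v) <= nrm u + nrm v].

Definition dual_norm m (nrm : 'rV[R]_m -> R) (y : 'rV[R]_m) : R :=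
  sup [set dotv y u | u in [set u | nrm u <= 1]].

Definition cvx_set m (A : set 'rV[R]_m) : Prop :=
  forall x y (t : R), A x -> A y -> 0 <= t <= 1 -> A (t *: x + (1 - t) *: y).

Definition cvx_on m (A : set 'rV[R]_m) (h : 'rV[R]_m -> R) : Prop :=
  forall x y (t : R), A x -> A y -> 0 <= t <= 1 ->
    h (t *: x + (1 - t) *: y) <= t * h x + (1 - t) * h y.

Definition bregman m (w : 'rV[R]_m -> R) (dw : 'rV[R]_m -> 'rV[R]_m)
  (z x : 'rV[R]_m) : R := w x - w z - dotv (dw z) (x - z).

Definition is_argmin m (A : set 'rV[R]_m) (h : 'rV[R]_m -> R) (u : 'rV[R]_m) : Prop :=
  A u /\ forall v, A v -> h u <= h v.

Definition prox_obj m (w : 'rV[R]_m -> R) (dw : 'rV[R]_m -> 'rV[R]_m)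
  (v y : 'rV[R]_m) (gam : R) (u : 'rV[R]_m) : R :=
  dotv y u + gam^-1 * bregman w dw v u.

Variables (b : nat) (ni : 'I_b -> nat).
Local Notation vec := 'rV[R]_(\sum_(i < b) ni i).

Definition prod_set (Xs : forall i : 'I_b, set 'rV[R]_(ni i)) : set vec :=
  [set x | forall i, Xs i (submxrow x i)].

Definition sbmd_step
  (P : forall i : 'I_b, 'rV[R]_(ni i) -> 'rV[R]_(ni i) -> R -> 'rV[R]_(ni i))
  (x Gx : vec) (ik : 'I_b) (gam : R) : vec :=
  \mxrow_(j < b) (if j == ik then P j (submxrow x j) (submxrow Gx j) gam
                  else submxrow x j).

(** The SBMD iterates x_k (k >= 1), for realizations [xis] of xi_1, xi_2, ...
    and [ids] of i_1, i_2, ...:  x_1 = x1 and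
    x_{k+1} = step(x_k, G(x_k, xi_k), i_k, gamma_k).  (Index 0 is unused.) *)
Fixpoint sbmd_iter (T : Type)
  (P : forall i : 'I_b, 'rV[R]_(ni i) -> 'rV[R]_(ni i) -> R -> 'rV[R]_(ni i))
  (G : vec -> T -> vec) (gam : nat -> R) (x1 : vec)
  (xis : nat -> T) (ids : nat -> 'I_b) (k : nat) : vec :=
  match k with
  | 0 => x1
  | k'.+1 =>
      if k' is 0 then x1
      else let xk := sbmd_iter P G gam x1 xis ids k' in
           sbmd_step P xk (G xk (xis k')) (ids k') (gam k')
  end.

Definition sbmd_out (T : Type)
  (P : forall i : 'I_b, 'rV[R]_(ni i) -> 'rV[R]_(ni i) -> R -> 'rV[R]_(ni i))
  (G : vec -> T -> vec) (gam : nat -> R) (x1 : vec)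
  (xis : nat -> T) (ids : nat -> 'I_b) (N : nat) : vec :=
  (\sum_(1 <= k < N.+1) gam k)^-1 *:
    \sum_(1 <= k < N.+1) gam k *: sbmd_iter P G gam x1 xis ids k.

(** Measurable rectangles U x A (U open in R^n, A measurable in T) and joint
    (Borel(R^n) (x) T)-measurability of a real function on R^n x T. *)
Definition rect_sets d (T : measurableType d) : set (set (vec * T)) :=
  [set S | exists U A, [/\ open U, measurable A & S = U `*` A]].

Definition jointly_measurable d (T : measurableType d) (h : vec * T -> R) : Prop :=
  forall B : set R, measurable B -> smallest (sigma_algebra setT) (@rect_sets d T) (h @^-1` B).

End Defs.

(* Main.v *)
Require Import Defs.
From HB Require Import structures.
From mathcomp Require Import all_boot all_order all_algebra.
From mathcomp Require Import all_classical all_reals all_analysis.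
From mathcomp Require Import measurable_realfun ring lra.
Import Order.TTheory GRing.Theory Num.Theory numFieldNormedType.Exports.

Set Implicit Arguments.
Unset Strict Implicit.

(* The prox step on block i satisfies the three-point inequality
     V_i(x_{k+1}, x) <= V_i(x_k, x) + gam_k <G_i, x - x_k> + gam_k^2 / 2 |G_i|_*^2,
   whose right-hand side is nonnegative.  The current iterate is a measurable function
   of (xi_j, i_j), j < k, and the sigma-algebra which they generate is independent of
   (xi_k, i_k); Tonelli's theorem therefore gives
     E V_i(x_{k+1}, x) + p_i gam_k E <g_i(x_k), x_k - x>
       <= E V_i(x_k, x) + p_i gam_k^2 / 2 M_i^2.
   Telescoping over k, dividing by p_i and summing over i bounds the expectation of
   sum_k gam_k <g(x_k), x_k - x>, which dominates (sum_k gam_k) (f(xbar) - f(x)). *)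

Local Open Scope classical_set_scope.
Local Open Scope ring_scope.

(** Most of the work is measurability and integrability. [P] is given only as a minimizer at each
    point, so its measurability is derived: with [s = gam *: y - dw v] the prox problem is to
    minimize [<s, u> + w u], and strong convexity makes the minimizer Lipschitz in [s]. Neither
    V_i(x_k, x) nor the gain [gam_k <g_i(x_k), x_k - x>] is assumed integrable. Since the one-step
    bound is nonnegative for either sign of the stepsize, taking its mean with both signs gives
    [|gain| <= V_i + gam_k^2 / 2 M_i^2]; integrability of V_i then passes from one step to the next
    inside the same induction as the inequality. Blocks stay separate until the end: V_i changes
    only on the event [i_k = i], which has probability p_i and is independent of the past, hence the
    factor p_i. Measurability of f(xbar) is never established; only monotonicity of the integral is
    applied to it. *)

Section Dotv.
Context {R : realType} {m : nat}.
Implicit Types (x y u v : 'rV[R]_m) (a : R).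

Lemma dotvDl x y u : dotv (x + y) u = dotv x u + dotv y u.
Proof. by rewrite /dotv -big_split; apply: eq_bigr => j _; rewrite mxE mulrDl. Qed.

Lemma dotvDr u x y : dotv u (x + y) = dotv u x + dotv u y.
Proof. by rewrite /dotv -big_split; apply: eq_bigr => j _; rewrite mxE mulrDr. Qed.

Lemma dotvZl a x u : dotv (a *: x) u = a * dotv x u.
Proof. by rewrite /dotv mulr_sumr; apply: eq_bigr => j _; rewrite mxE mulrA. Qed.

Lemma dotvZr a x u : dotv x (a *: u) = a * dotv x u.
Proof. by rewrite /dotv mulr_sumr; apply: eq_bigr => j _; rewrite mxE mulrCA. Qed.

Lemma dotvNl x u : dotv (- x) u = - dotv x u.
Proof. by rewrite -scaleN1r dotvZl mulN1r. Qed.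

Lemma dotvNr x u : dotv x (- u) = - dotv x u.
Proof. by rewrite -scaleN1r dotvZr mulN1r. Qed.

Lemma dotvBl x y u : dotv (x - y) u = dotv x u - dotv y u.
Proof. by rewrite dotvDl dotvNl. Qed.

Lemma dotvBr u x y : dotv u (x - y) = dotv u x - dotv u y.
Proof. by rewrite dotvDr dotvNr. Qed.

Lemma dotvC x y : dotv x y = dotv y x.
Proof. by apply: eq_bigr => j _; rewrite mulrC. Qed.

Lemma dotv0 x : dotv x 0 = 0.
Proof. by rewrite -(scale0r 0) dotvZr mul0r. Qed.

Lemma dotv_sumr I (r : seq I) (Q : pred I) (h : I -> 'rV[R]_m) x :
  dotv x (\sum_(i <- r | Q i) h i) = \sum_(i <- r | Q i) dotv x (h i).
Proof. by apply: (big_morph (dotv x)); [exact: dotvDr | exact: dotv0]. Qed.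

Lemma rV_coord_le x j : `|x ord0 j| <= `|x|.
Proof.
rewrite [leRHS]mx_normrE.
exact: (le_bigmax_cond _ (fun ij : 'I_1 * 'I_m => `|x ij.1 ij.2|) (j := (ord0, j))).
Qed.

Lemma rV_norm_lt x (e : R) : 0 < e -> (forall j, `|x ord0 j| < e) -> `|x| < e.
Proof.
move=> e0 xe; rewrite [ltLHS]mx_normrE bigmax_lt// => -[i j] _ /=.
by rewrite (ord1 i).
Qed.

Lemma le_dotv_norm x y : dotv x y <= m%:R * (`|x| * `|y|).
Proof.
have -> : m%:R * (`|x| * `|y|) = \sum_(j < m) `|x| * `|y|.
  by rewrite sumr_const card_ord mulr_natl.
by apply: ler_sum => j _; rewrite (le_trans (ler_norm _))// normrM ler_pM// rV_coord_le.
Qed.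

End Dotv.

(** * Equivalence of norms, and the dual norm *)

Section Norm.
Context {R : realType} {m : nat} {nrm : 'rV[R]_m -> R}.
Hypothesis nrmP : is_norm nrm.

Lemma is_norm0 : nrm 0 = 0.
Proof. by case: nrmP => _ _ nZ _; rewrite -(scale0r 0) nZ normr0 mul0r. Qed.

Lemma is_normN u : nrm (- u) = nrm u.
Proof. by case: nrmP => _ _ nZ _; rewrite -scaleN1r nZ normrN1 mul1r. Qed.

Lemma is_norm_le_sup : exists2 K, 0 <= K & forall u, nrm u <= K * `|u|.
Proof.
have [n0 _ nZ nD] := nrmP.
exists (\sum_(j < m) nrm (delta_mx ord0 j)); first exact: sumr_ge0.
move=> u; rewrite {1}(row_sum_delta u) mulr_suml.
apply: (le_trans (y := \sum_(j < m) nrm (u ord0 j *: delta_mx ord0 j))).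
  elim/big_ind2 : _ => [|a b c d ab cd|j _]; rewrite ?is_norm0//.
  by rewrite (le_trans (nD _ _))// lerD.
by apply: ler_sum => j _; rewrite nZ mulrC ler_wpM2l// rV_coord_le.
Qed.

Lemma is_norm_continuous : continuous nrm.
Proof.
have [n0 _ nZ nD] := nrmP; have [K K0 nK] := is_norm_le_sup.
have tri u v : nrm u - nrm v <= K * `|u - v|.
  by rewrite lerBlDr -{1}(subrK v u) (le_trans (nD _ _))// lerD2r.
move=> u; apply/(@cvgrPdist_le _ _ _ (nbhs u) (nbhs_filter u)) => /= e e0.
have d0 : 0 < e / (K + 1) by rewrite divr_gt0// ltr_wpDl.
apply/nbhs_ballP; exists (e / (K + 1)) => //= v; rewrite -ball_normE /= => /ltW uv.
have Ke : K * `|u - v| <= e.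
  rewrite (le_trans (ler_wpM2l K0 uv))// mulrCA ger_pMr// ler_pdivrMr ?ltr_wpDl//.
  by rewrite mul1r lerDl.
rewrite ler_norml lerNl opprB (le_trans (tri u v))// andbT.
by rewrite (le_trans (tri v u))// distrC.
Qed.

(** The constant is the minimum of [nrm] on the compact unit sphere of the sup norm, positive by
    definiteness. *)
Lemma is_norm_ge_sup : exists2 c, 0 < c & forall u, c * `|u| <= nrm u.
Proof.
have [n0 nI nZ nD] := nrmP.
pose S := [set u : 'rV[R]_m | `|u| = 1].
(* The sphere is empty only in dimension 0, where every vector is 0 and any constant works. *)
have [S0|/set0P S0] := eqVneq S set0.
  exists 1 => // u; have [->|u0] := eqVneq u 0; first by rewrite normr0 mulr0.
  have : S (`|u|^-1 *: u).
    by rewrite /S/= normrZ normfV normr_id mulVf// normr_eq0.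
  by rewrite S0.
have cS : compact S.
  apply: bounded_closed_compact.
    by exists 1; split => // M M1 u /= ->; exact: ltW.
  rewrite (_ : S = (fun u : 'rV[R]_m => `|u|) @^-1` [set 1]); last by [].
  apply: closed_comp; last exact: closed_eq.
  by move=> u _; exact: norm_continuous.
have [c /set_mem cin cmin] := EVT_min_rV S0 cS
  (continuous_subspaceT is_norm_continuous).
have c0 : 0 < nrm c.
  rewrite lt_def n0 andbT; apply/eqP => /nI c0.
  by move: cin; rewrite c0 /S/= normr0 => /esym/eqP; rewrite oner_eq0.
exists (nrm c) => // u; have [->|u0] := eqVneq u 0; first by rewrite normr0 mulr0.
have Su : S (`|u|^-1 *: u).
  by rewrite /S/= normrZ normfV normr_id mulVf// normr_eq0.
have := cmin _ (mem_set Su); rewrite nZ normfV normr_id => cu.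
by rewrite -ler_pdivlMr ?normr_gt0// mulrC.
Qed.

Let dual_set (y : 'rV[R]_m) := [set dotv y u | u in [set u | nrm u <= 1]].

(** [sup] is informative only for a nonempty set that is bounded above; the bound comes from
    [is_norm_ge_sup], by which the unit ball of [nrm] is bounded. *)
Lemma dual_norm_has_sup y : has_sup (dual_set y).
Proof.
have [c c0 nc] := is_norm_ge_sup; split.
  by exists 0; exists 0; rewrite ?dotv0//= is_norm0.
exists (m%:R * (`|y| * c^-1)) => _ [u /= u1 <-].
rewrite (le_trans (le_dotv_norm _ _))// ler_wpM2l// ler_wpM2l//.
by rewrite -[leRHS]mul1r ler_pdivlMr// mulrC (le_trans (nc u)).
Qed.

Lemma dotv_le_dual_norm1 y u : nrm u <= 1 -> dotv y u <= dual_norm nrm y.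
Proof.
by move=> u1; apply: ub_le_sup; [case: (dual_norm_has_sup y) | exists u].
Qed.

Lemma dotv_le_dual_norm y u : dotv y u <= dual_norm nrm y * nrm u.
Proof.
have [n0 nI nZ _] := nrmP.
have [nu0|nu0] := eqVneq (nrm u) 0; first by rewrite (nI _ nu0) dotv0 is_norm0 mulr0.
have nu : 0 < nrm u by rewrite lt_def nu0 n0.
rewrite -ler_pdivrMr// mulrC -dotvZr dotv_le_dual_norm1//.
by rewrite nZ ger0_norm ?invr_ge0// mulVf.
Qed.

(** Exchanging [y] and [z] gives Lipschitz continuity, on which [measurable_dual_norm] rests. *)
Lemma dual_norm_lip : exists2 C, 0 <= C &
  forall y z, dual_norm nrm y <= dual_norm nrm z + C * `|y - z|.
Proof.
have [c c0 nc] := is_norm_ge_sup.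
exists (m%:R * c^-1); first by rewrite mulr_ge0// invr_ge0 ltW.
move=> y z; apply: ge_sup; first by case: (dual_norm_has_sup y).
move=> _ [u /= u1 <-]; rewrite -{1}(subrK z y) dotvDl addrC lerD//.
  exact: dotv_le_dual_norm1.
rewrite (le_trans (le_dotv_norm _ _))// -mulrA ler_wpM2l// mulrC ler_wpM2r//.
by rewrite -[leRHS]mul1r ler_pdivlMr// mulrC (le_trans (nc u)).
Qed.

End Norm.

(** * Strong convexity, the three-point inequality and stability of the prox-mapping *)

Section Prox.
Context {R : realType} {m : nat} {X : set 'rV[R]_m} {nrm : 'rV[R]_m -> R}.
Context {w : 'rV[R]_m -> R} {dw : 'rV[R]_m -> 'rV[R]_m}.
Hypothesis Xcvx : cvx_set X.
Hypothesis nrmP : is_norm nrm.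
Hypothesis w_diff : forall z, X z ->
  differentiable w z /\ forall u, 'd w z u = dotv (dw z) u.
Hypothesis w_sc : forall x z, X x -> X z ->
  dotv (x - z) (dw x - dw z) >= nrm (x - z) ^+ 2.

Lemma cvx_set_line u v (t : R) : X u -> X v -> 0 <= t <= 1 -> X (u + t *: (v - u)).
Proof.
move=> Xu Xv t01; rewrite (_ : _ + _ = t *: v + (1 - t) *: u); first exact: Xcvx.
by rewrite scalerBr scalerBl scale1r addrCA.
Qed.

Lemma derivable_dir z d : X z -> derivable w z d.
Proof. by move=> /w_diff[wz _]; exact: diff_derivable. Qed.

Lemma derive_dir z d : X z -> 'D_d w z = dotv (dw z) d.
Proof. by move=> /w_diff[wz dE]; rewrite deriveE// dE. Qed.

Lemma is_derive_line z d (t : R) : X (z + t *: d) ->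
  is_derive t (1 : R) (fun s : R => w (z + s *: d)) (dotv (dw (z + t *: d)) d).
Proof.
move=> Xt; pose q (h : R) := h^-1 *: ((w \o shift (z + t *: d)) (h *: d) - w (z + t *: d)).
have qE : (fun h : R => h^-1 *: (((fun s : R => w (z + s *: d)) \o shift t) (h *: 1)
    - w (z + t *: d))) = q.
  apply/funext => h; rewrite /q /= [h *: 1]mulr1.
  by rewrite scalerDl addrCA.
apply: DeriveDef; rewrite /derivable /derive qE.
  exact: derivable_dir.
exact: derive_dir.
Qed.

(** First-order optimality: the segment from [u] to [x] stays in [X] by convexity, so the right
    difference quotients of the objective along it are nonnegative, and so is their limit. *)
Lemma argmin_variational s u x : is_argmin X (fun v => dotv s v + w v) u ->
  X x -> 0 <= dotv (s + dw u) (x - u).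
Proof.
move=> [Xu minu] Xx; rewrite dotvDl -[X in _ + X]derive_dir// -lerBlDl sub0r.
have /cvg_dnbhs_at_right cv := derivable_dir (d := x - u) Xu.
apply: (cvgr_to_ge cv).
near=> h.
have h0 : 0 < h by [].
have h1 : h <= 1 by near: h; apply: nbhs_right_le.
have := minu _ (cvx_set_line Xu Xx (t := h) ltac:(by rewrite (ltW h0) h1)).
rewrite dotvDr dotvZr => H.
rewrite /= [h^-1 *: _]/(h^-1 * _) ler_pdivlMl// [h *: _ + u]addrC; lra.
Unshelve. all: by end_near. Qed.

(** [phi] is [w] along the segment minus its linear part and the quadratic to be gained; the claim
    amounts to [phi 0 <= phi 1], which the mean value theorem reduces to [0 <= dphi t] at one
    interior point. *)
Lemma bregman_ge z x : X z -> X x -> 2^-1 * nrm (x - z) ^+ 2 <= bregman w dw z x.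
Proof.
move=> Xz Xx; set d := x - z; have [_ _ nZ _] := nrmP.
pose a := dotv (dw z) d; pose c := nrm d ^+ 2.
pose phi (t : R) := w (z + t *: d) - (a * t + 2^-1 * c * t ^+ 2).
pose dphi (t : R) := dotv (dw (z + t *: d)) d - (a + c * t).
have phiD (t : R) : 0 <= t <= 1 -> is_derive t (1 : R) phi (dphi t).
  move=> t01; have Xt := cvx_set_line Xz Xx t01.
  have ? := is_derive_line Xt.
  apply: is_derive_eq; rewrite /dphi -/d.
  by set D := dotv _ d; rewrite /GRing.scale/=; field.
have [||t t01] := @MVT _ phi dphi 0 1 ltr01.
- by move=> t; rewrite in_itv/= => /andP[t0 t1]; apply: phiD; rewrite !ltW.
- apply: derivable_within_continuous => t; rewrite in_itv/= => t01.
  by have ? := phiD _ t01; exact: ex_derive.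
rewrite subr0 mulr1 /phi scale1r scale0r addr0 mulr0 add0r expr0n/= mulr0 subr0.
rewrite expr1n !mulr1 [z + d]addrCA subrr addr0 => E.
have [t0 t1] : 0 < t /\ t < 1 by move: t01; rewrite in_itv/= => /andP.
(* Strong convexity between [z + t *: d] and [z] gives [t * <dw (z + t *: d) - dw z, d> >= t^2 * c];
   divide by [t > 0]. *)
have : 0 <= dphi t.
  have Xt : X (z + t *: d) by apply: cvx_set_line; rewrite // !ltW.
  have := w_sc Xt Xz; rewrite addrAC subrr add0r nZ gtr0_norm// dotvZl exprMn.
  rewrite expr2 -mulrA ler_pM2l// dotvC dotvBl -/a -/c /dphi; lra.
rewrite -E /bregman -/d -/a -/c; lra.
Unshelve. all: by end_near. Qed.

Lemma prox_objE v y (gam : R) u : 0 < gam ->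
  gam * prox_obj w dw v y gam u =
  dotv (gam *: y - dw v) u + w u + (dotv (dw v) v - w v).
Proof.
by move=> g0; rewrite /prox_obj /bregman !dotvBr dotvBl dotvZl; field; rewrite gt_eqF.
Qed.

(** Up to the positive factor [gam] and an additive constant, the objective depends on [(v, y)] only
    through [gam *: y - dw v]; this puts the prox step in the form treated by [argmin_variational]
    and [argmin_lip]. *)
Lemma prox_argmin v y (gam : R) u : 0 < gam ->
  is_argmin X (prox_obj w dw v y gam) u ->
  is_argmin X (fun z => dotv (gam *: y - dw v) z + w z) u.
Proof.
move=> g0 [Xu minu]; split=> // z Xz; have := minu z Xz.
by rewrite -(ler_pM2l g0) !prox_objE// lerD2r.
Qed.

(** Optimality of [u] tested at [x] leaves the error [gam * <y, v - u> - V(v, u)]. With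
    [V(v, u) >= n^2 / 2], Young's inequality [gam * D * n <= n^2 / 2 + gam^2 * D^2 / 2] absorbs
    it. *)
Lemma prox_three_point v y (gam : R) u x : X v -> X x -> 0 < gam ->
  is_argmin X (prox_obj w dw v y gam) u ->
  bregman w dw u x <= bregman w dw v x + gam * dotv y (x - v)
    + 2^-1 * (gam ^+ 2 * dual_norm nrm y ^+ 2).
Proof.
move=> Xv Xx g0 uP; have [Xu _] := uP.
have := argmin_variational (prox_argmin g0 uP) Xx.
have := bregman_ge Xv Xu.
have := dotv_le_dual_norm nrmP y (v - u).
rewrite -(ler_pM2l g0) -[nrm (v - u)](is_normN nrmP) opprB.
set n := nrm _; set D := dual_norm _ _.
have := sqr_ge0 (n - gam * D).
rewrite /bregman !(dotvBr, dotvBl, dotvDl, dotvNl, dotvZl); nra.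
Qed.

(* Cauchy-Schwarz and AM-GM make the one-step upper bound of [prox_three_point]
   nonnegative, so that its expectation can be computed by Tonelli's theorem. *)
Lemma prox_bound_ge0 v y (gam : R) x : X v -> X x ->
  0 <= bregman w dw v x + gam * dotv y (x - v)
    + 2^-1 * (gam ^+ 2 * dual_norm nrm y ^+ 2).
Proof.
move=> Xv Xx; have := bregman_ge Xv Xx.
have := dotv_le_dual_norm nrmP y (x - v); have := dotv_le_dual_norm nrmP y (- (x - v)).
rewrite (is_normN nrmP) dotvNr; set n := nrm _; set D := dual_norm _ _.
set q := dotv y _ => q1 q2.
(* Squares are compared because [gam] may have either sign here; [block_gain_le] relies on the
   negative case. *)
have : (gam * q) ^+ 2 <= (gam * (D * n)) ^+ 2.
  rewrite !exprMn ler_wpM2l ?sqr_ge0// -exprMn -[leRHS]ger0_norm ?sqr_ge0//.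
  rewrite -[leLHS]ger0_norm ?sqr_ge0// !normrX lerXn2r ?nnegrE// .
  by rewrite [leRHS]ger0_norm ?ler_norml; lra.
have := sqr_ge0 (n - gam * D); have := sqr_ge0 (n + gam * D).
nra.
Qed.

(** Adding the variational inequalities of [u1] and [u2], each tested at the other point, gives [<u1
    - u2, dw u1 - dw u2> <= <s1 - s2, u2 - u1>]. Strong convexity bounds the left side below by a
    multiple of [|u1 - u2|^2], and one factor [|u1 - u2|] cancels. *)
Lemma argmin_lip : exists2 L, 0 < L & forall s1 s2 u1 u2,
  is_argmin X (fun z => dotv s1 z + w z) u1 ->
  is_argmin X (fun z => dotv s2 z + w z) u2 -> `|u1 - u2| <= L * `|s1 - s2|.
Proof.
have [c c0 nc] := is_norm_ge_sup nrmP.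
(* The added 1 keeps the constant positive in dimension 0. *)
exists (m%:R / c ^+ 2 + 1); first by rewrite ltr_wpDl// divr_ge0// sqr_ge0.
move=> s1 s2 u1 u2 P1 P2; have [Xu1 _] := P1; have [Xu2 _] := P2.
have := argmin_variational P1 Xu2; have := argmin_variational P2 Xu1.
have := w_sc Xu1 Xu2; have := le_dotv_norm (s1 - s2) (u2 - u1).
have := nc (u1 - u2); have := normr_ge0 (u1 - u2).
rewrite (distrC u2).
set a := `|u1 - u2|; set e := `|s1 - s2| => a0 na H1 H2 H3 H4.
have e0 : 0 <= e by exact: normr_ge0.
have ca : (c * a) ^+ 2 <= m%:R * (e * a).
  apply: le_trans (_ : nrm (u1 - u2) ^+ 2 <= _); last first.
    move: H1 H2 H3 H4; rewrite [dotv (u1 - u2) _]dotvC.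
    rewrite !(dotvBr, dotvBl, dotvDl); lra.
  by rewrite lerXn2r ?nnegrE//; [exact: mulr_ge0 (ltW c0) a0 | exact: le_trans (mulr_ge0 (ltW c0) a0) na].
have [->|an0] := eqVneq a 0; first by rewrite mulr_ge0// ltW// ltr_wpDl// divr_ge0// sqr_ge0.
have {an0} a0' : 0 < a by rewrite lt_def an0.
apply: (le_trans (y := m%:R / c ^+ 2 * e)); last by rewrite ler_wpM2r// lerDl.
rewrite mulrAC ler_pdivlMr ?exprn_gt0// -(ler_pM2r a0').
by move: ca; rewrite exprMn expr2; lra.
Qed.

End Prox.

(** * Measurability of vector-valued maps *)

Section RowMeasurability.
Context {R : realType} {d : measure_display} {S : measurableType d}.

(** Coordinatewise form of Borel measurability; [rV_measurable_open] recovers preimages of open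
    sets. *)
Definition rV_measurable m (s : S -> 'rV[R]_m) :=
  forall j, measurable_fun setT (fun z => s z ord0 j).

Section Open.
Context {m : nat}.
Implicit Types s : S -> 'rV[R]_m.

Let box (qr : 'rV[rat]_m * rat) : set 'rV[R]_m :=
  [set u | forall j, `|u ord0 j - ratr (qr.1 ord0 j)| < ratr qr.2].

Let box_measurable s qr : rV_measurable s -> measurable (s @^-1` box qr).
Proof.
move=> ms; rewrite (_ : _ @^-1` _ = \bigcap_(j in [set: 'I_m])
  (fun z => s z ord0 j) @^-1` [set y | `|y - ratr (qr.1 ord0 j)| < ratr qr.2]).
  apply: fin_bigcap_measurable => // j _; rewrite -[X in measurable X]setTI.
  apply: ms => //; apply: open_measurable.
  rewrite (_ : [set _ | _] = ball (ratr (qr.1 ord0 j) : R) (ratr qr.2)).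
    exact: ball_open.
  by apply/seteqP; split => y; rewrite -ball_normE /= distrC.
by apply/seteqP; split => z /= h j; [move=> _|]; exact: h.
Qed.

(** Rational boxes form a countable base. Those not inside [U] are replaced by [set0], so that the
    union ranges over a whole countable type. *)
Let open_bigcup_box (U : set 'rV[R]_m) : open U ->
  U = \bigcup_qr (if pselect (box qr `<=` U) then box qr else set0).
Proof.
move=> oU; apply/seteqP; split=> [u Uu|u [qr _]]; last by case: pselect => // h /h.
have : nbhs u U by exact: open_nbhs_nbhs.
move=> /nbhs_ballP[e /= e0 eU].
have /rat_in_itvoo[r] : 0 < e / 2 :> R by rewrite divr_gt0.
rewrite in_itv/= => /andP[r0 re].
have /choice[q qP] : forall j, exists q : rat,
    (ratr q : R) \in `](u ord0 j - ratr r), (u ord0 j + ratr r)[.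
  by move=> j; apply: rat_in_itvoo; rewrite ltrD2l gtrN.
pose qr : 'rV[rat]_m * rat := (\row_j q j, r); exists qr => //.
have uqr : box qr u.
  move=> j; rewrite /= mxE; have := qP j; rewrite in_itv/= => /andP[q1 q2].
  by rewrite ltr_norml; apply/andP; split; lra.
case: pselect => [//|[]] v vqr; apply: eU.
rewrite -ball_normE /=; apply: rV_norm_lt => // j.
rewrite !mxE -(subrK (ratr (q j)) (u ord0 j)) -addrA.
have := uqr j; have := vqr j; rewrite /= !mxE distrC => h1 h2.
by rewrite (le_lt_trans (ler_normD _ _))//; lra.
Qed.

Lemma rV_measurable_open s U : rV_measurable s -> open U -> measurable (s @^-1` U).
Proof.
move=> ms /open_bigcup_box ->; rewrite preimage_bigcup.
apply: countable_bigcupT_measurable; first exact: countableP.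
by move=> qr; case: pselect => ? /=; [exact: box_measurable|rewrite preimage_set0].
Qed.

(** [h] is only asked to be continuous relative to [s]: then [h > a] is the preimage under [s] of a
    union of balls, which is open however many balls enter. This covers functions continuous merely
    on the sets X_i, since the iterates stay in them. *)
Lemma measurable_fun_rV_modulus s (h : S -> R) : rV_measurable s ->
  (forall z e, 0 < e -> exists2 r : R, 0 < r &
     forall z', `|s z' - s z| < r -> `|h z' - h z| < e) ->
  measurable_fun setT h.
Proof.
move=> ms hh; apply: (measurability _ (RGenOInfty.measurableE R)) => //.
move=> _ [_ [a ->] <-]; rewrite setTI.
pose U := \bigcup_(zr in [set zr : S * R | 0 < zr.2 /\
  forall z', `|s z' - s zr.1| < zr.2 -> a < h z']) ball (s zr.1) zr.2.
rewrite (_ : h @^-1` _ = s @^-1` U).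
  by apply: rV_measurable_open => //; apply: bigcup_open => zr _; exact: ball_open.
apply/seteqP; split => z /=.
  rewrite in_itv/= andbT => az.
  have [r r0 rh] := hh z (h z - a) ltac:(by rewrite subr_gt0).
  exists (z, r) => /=; last by rewrite -ball_normE /= subrr normr0.
  split=> // z' /rh; rewrite ltr_norml => /andP[+ _]; lra.
move=> [[z0 r]/= [r0 rh]]; rewrite -ball_normE /= distrC => /rh.
by rewrite in_itv/= andbT.
Qed.

End Open.

Lemma within_continuous_modulus m (V : normedModType R) (A : set 'rV[R]_m)
    (h : 'rV[R]_m -> V) x (e : R) : {within A, continuous h} -> A x -> 0 < e ->
  exists2 r : R, 0 < r & forall y, A y -> `|y - x| < r -> `|h y - h x| < e.
Proof.
move=> /subspace_continuousP/(_ x) ch Ax e0.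
have /nbhs_ballP[r /= r0 rP] : nbhs x [set y | A y -> `|h x - h y| < e].
  have := ch Ax; move/(@cvgrPdist_lt _ _ _ (within A (nbhs x))
    (within_filter A (nbhs_filter x)))/(_ e e0).
  by rewrite near_withinE.
exists r => // y Ay yx; rewrite distrC; apply: rP => //.
by rewrite -ball_normE /= distrC.
Qed.

Lemma measurable_fun_within m (A : set 'rV[R]_m) (h : 'rV[R]_m -> R) (s : S -> 'rV[R]_m) :
  {within A, continuous h} -> (forall z, A (s z)) -> rV_measurable s ->
  measurable_fun setT (h \o s).
Proof.
move=> ch As ms; apply: (measurable_fun_rV_modulus ms) => z e e0.
have [r r0 rP] := within_continuous_modulus ch (As z) e0.
by exists r => // z' zz'; exact: rP.
Qed.

Lemma rV_measurable_within m n (A : set 'rV[R]_m) (h : 'rV[R]_m -> 'rV[R]_n)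
    (s : S -> 'rV[R]_m) :
  {within A, continuous h} -> (forall z, A (s z)) -> rV_measurable s ->
  rV_measurable (h \o s).
Proof.
move=> ch As ms j; apply: (measurable_fun_rV_modulus ms) => z e e0.
have [r r0 rP] := within_continuous_modulus ch (As z) e0.
exists r => // z' zz'; rewrite (le_lt_trans _ (rP _ (As z') zz'))//.
by have := rV_coord_le (h (s z') - h (s z)) j; rewrite !mxE.
Qed.

Lemma rV_measurable_lip m n (L : R) (s : S -> 'rV[R]_m) (u : S -> 'rV[R]_n) :
  0 < L -> (forall z z', `|u z' - u z| <= L * `|s z' - s z|) ->
  rV_measurable s -> rV_measurable u.
Proof.
move=> L0 uL ms j; apply: (measurable_fun_rV_modulus ms) => z e e0.
exists (e / L); first exact: divr_gt0.
move=> z' zz'; have := rV_coord_le (u z' - u z) j; rewrite !mxE => h.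
by rewrite (le_lt_trans h)// (le_lt_trans (uL _ _))// mulrC -ltr_pdivlMr.
Qed.

Lemma rV_measurableD m (s u : S -> 'rV[R]_m) : rV_measurable s -> rV_measurable u ->
  rV_measurable (fun z => s z + u z).
Proof.
move=> ms mu j; rewrite (_ : (fun _ => _) = (fun z => s z ord0 j) \+ (fun z => u z ord0 j)).
  exact: measurable_funD.
by apply/funext => z; rewrite mxE.
Qed.

Lemma rV_measurableZ m (a : R) (s : S -> 'rV[R]_m) : rV_measurable s ->
  rV_measurable (fun z => a *: s z).
Proof.
move=> ms j; rewrite (_ : (fun _ => _) = (fun z => a * s z ord0 j)).
  exact: measurable_funM.
by apply/funext => z; rewrite mxE.
Qed.

Lemma rV_measurable_cst m (x : 'rV[R]_m) : rV_measurable (fun=> x).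
Proof. by move=> j; exact: measurable_cst. Qed.

Lemma rV_measurableB m (s u : S -> 'rV[R]_m) : rV_measurable s -> rV_measurable u ->
  rV_measurable (fun z => s z - u z).
Proof.
move=> ms mu; have := rV_measurableD ms (rV_measurableZ (-1) mu).
by under [X in rV_measurable X]eq_fun do rewrite scaleN1r.
Qed.

Lemma measurable_dotv m (s u : S -> 'rV[R]_m) : rV_measurable s -> rV_measurable u ->
  measurable_fun setT (fun z => dotv (s z) (u z)).
Proof.
by move=> ms mu; apply: measurable_sum => j; exact: measurable_funM.
Qed.

Lemma measurable_dual_norm m (nrm : 'rV[R]_m -> R) (s : S -> 'rV[R]_m) :
  is_norm nrm -> rV_measurable s -> measurable_fun setT (fun z => dual_norm nrm (s z)).
Proof.
move=> nP ms; apply: (measurable_fun_rV_modulus ms) => z e e0.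
have [C C0 nC] := dual_norm_lip nP.
exists (e / (C + 1)); first by rewrite divr_gt0// ltr_wpDl.
move=> z'; rewrite ltr_pdivlMr ?ltr_wpDl// => zz'.
have := nC (s z') (s z); have := nC (s z) (s z'); rewrite (distrC (s z)).
have := normr_ge0 (s z' - s z).
by rewrite ltr_norml => ? ? ?; apply/andP; split; nra.
Qed.

Lemma rV_measurable_submxrow b (ni : 'I_b -> nat)
    (s : S -> 'rV[R]_(\sum_(i < b) ni i)) i :
  rV_measurable s -> rV_measurable (fun z => submxrow (s z) i).
Proof.
move=> ms j; rewrite (_ : (fun _ => _) = fun z => s z ord0 (tagnat.Rank i j)); first exact: ms.
by apply/funext => z; rewrite mxE.
Qed.

Lemma rV_measurable_mxrow b (ni : 'I_b -> nat) (s : forall i, S -> 'rV[R]_(ni i)) :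
  (forall i, rV_measurable (s i)) -> rV_measurable (fun z => \mxrow_(i < b) s i z).
Proof.
move=> ms j; rewrite (_ : (fun _ => _) = fun z => s (tagnat.sig1 j) z ord0 (tagnat.sig2 j)).
  exact: ms.
by apply/funext => z; rewrite mxE.
Qed.

(** The sets whose preimage under [phi] is measurable form a sigma-algebra containing the generating
    rectangles. *)
Lemma jointly_measurable_comp b (ni : 'I_b -> nat) d' (T : measurableType d')
    (h : 'rV[R]_(\sum_(i < b) ni i) * T -> R)
    (s : S -> 'rV[R]_(\sum_(i < b) ni i)) (z : S -> T) :
  rV_measurable s -> measurable_fun setT z -> jointly_measurable h ->
  measurable_fun setT (fun w => h (s w, z w)).
Proof.
move=> ms mz mh _ B /mh hB; rewrite setTI.
pose phi w := (s w, z w).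
suff : image_set_system setT phi measurable (h @^-1` B).
  by rewrite /image_set_system/= setTI.
apply: smallest_sub hB; first exact/sigma_algebra_image/sigma_algebra_measurable.
move=> _ [U [A [oU mA ->]]]; rewrite /image_set_system/= setTI.
rewrite (_ : _ @^-1` _ = s @^-1` U `&` z @^-1` A)//.
apply: measurableI; first exact: rV_measurable_open.
by rewrite -[X in measurable X]setTI; exact: mz.
Qed.

End RowMeasurability.

(** * Tonelli's theorem under independence *)

Section IndependentIntegration.
Context {d dS dT : measure_display} {Omega : measurableType d} {S : measurableType dS}.
Context {T : measurableType dT} {R : realType}.
Local Open Scope ereal_scope.

Lemma ge0_integral_mrestr (m : {measure set Omega -> \bar R}) (D : set Omega)
    (mD : measurable D) (f : Omega -> \bar R) :
  measurable_fun setT f -> (forall z, 0 <= f z) ->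
  \int[mrestr m mD]_z f z = \int[m]_(z in D) f z.
Proof.
move=> mf f0; rewrite (@ge0_negligible_integral _ _ _ (mrestr m mD) setT (~` D))//=.
- rewrite setTD setCK; apply: eq_measure_integral => A mA AD.
  by rewrite [LHS]/(m (A `&` D)) (setIidl AD).
- exact: measurableC.
- by rewrite /mrestr setICl; exact: measure0.
Qed.

(** The law of [(phi, zeta)] under [Pr] restricted to [D] is [c] times a product measure. [S] is
    left abstract because it will be [Omega] with a smaller sigma-algebra and [phi] the identity. *)
Lemma indep_tonelli (Pr : probability Omega R) (mu : probability T R)
    (phi : Omega -> S) (zeta : Omega -> T) (D : set Omega) (c : R)
    (q : S * T -> \bar R) :
  measurable_fun setT phi -> measurable_fun setT zeta -> measurable D -> (0 < c)%R ->
  (forall A B, measurable A -> measurable B ->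
     Pr (phi @^-1` A `&` (zeta @^-1` B `&` D)) = Pr (phi @^-1` A) * (mu B * c%:E)) ->
  measurable_fun setT q -> (forall x, 0 <= q x) ->
  \int[Pr]_(z in D) q (phi z, zeta z) =
  c%:E * \int[Pr]_z \int[mu]_t q (phi z, t).
Proof.
move=> mphi mzeta mD c0 ind mq q0.
pose pair z := (phi z, zeta z).
have mpair : measurable_fun setT pair by exact: measurable_fun_pair.
pose phi' : {mfun Omega >-> S} := HB.pack phi (isMeasurableFun.Build _ _ _ _ _ mphi).
pose m1 : probability S R := distribution Pr phi'.
pose PD : {measure set Omega -> \bar R} := mrestr Pr mD.
pose pushF : {measure set (S * T)%type -> \bar R} := pushforward PD pair.
pose push := pushF mpair.
have ci0 : (0 <= c^-1)%R by rewrite invr_ge0 ltW.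
pose m' : {measure set (S * T)%type -> \bar R} := mscale (NngNum ci0) push.
(* The pushforward has total mass [c]; dividing by [c] makes it agree on rectangles with a product
   of probabilities, which determines it. *)
have m'E X : measurable X -> (m1 \x mu) X = m' X.
  apply: product_measure_unique => A B mA mB.
  transitivity (c^-1%:E * Pr (pair @^-1` (A `*` B) `&` D)); first by [].
  rewrite (_ : _ `&` D = phi @^-1` A `&` (zeta @^-1` B `&` D)); last first.
    by apply/seteqP; split => z /= [] => [[]|? []].
  rewrite ind// (_ : m1 A * mu B = Pr (phi @^-1` A) * mu B)// muleCA; congr (_ * _).
  by rewrite muleCA -EFinM mulVf ?gt_eqF// mule1.
have qE : \int[m1 \x mu]_x q x = c^-1%:E * \int[push]_x q x.
  rewrite -(ge0_integral_mscale push measurableT (NngNum ci0))//.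
  by apply: eq_measure_integral => A mA _; exact: m'E.
have {}qE : \int[push]_x q x = c%:E * \int[m1 \x mu]_x q x.
  by rewrite qE muleA -EFinM mulfV ?gt_eqF// mul1e.
have mqp : measurable_fun setT (q \o pair) by exact: measurableT_comp.
transitivity (\int[push]_x q x).
  rewrite (ge0_integral_pushforward mpair PD measurableT mq) ?preimage_setT//.
  by rewrite ge0_integral_mrestr//= => z; exact: q0.
rewrite qE (fubini_tonelli1 _ mq)//; congr (_ * _).
have mF : measurable_fun setT (fubini_F mu q).
  exact: measurable_fun_fubini_tonelli_F.
rewrite (ge0_integral_pushforward mphi Pr measurableT mF) ?preimage_setT//.
by move=> x _; apply: integral_ge0.
Qed.

End IndependentIntegration.

(** * Independence of the past from the current sample and index *)

Section Past.
Context {R : realType} {b : nat} {dT dO : measure_display} {T : measurableType dT}.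
Context {mu : probability T R} {Omega : measurableType dO} {Pr : probability Omega R}.
Context {xi : nat -> Omega -> T} {idx : nat -> Omega -> 'I_b} {p : 'I_b -> R}.
Hypothesis p_gt0 : forall i, 0 < p i.
Hypothesis xi_meas : forall k, (1 <= k)%N -> measurable_fun setT (xi k).
Hypothesis xi_law : forall k, (1 <= k)%N -> forall A, measurable A ->
  Pr (xi k @^-1` A) = mu A.
Hypothesis idx_meas : forall k, (1 <= k)%N -> forall i, measurable (idx k @^-1` [set i]).
Hypothesis idx_law : forall k, (1 <= k)%N -> forall i, Pr (idx k @^-1` [set i]) = (p i)%:E.
Hypothesis indep : forall (n : nat) (A : nat -> set T) (B : nat -> set 'I_b),
  (forall k, measurable (A k)) ->
  Pr (\bigcap_(k in [set k | (1 <= k <= n)%N])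
        (xi k @^-1` A k `&` idx k @^-1` B k)) =
  (\prod_(1 <= k < n.+1) (Pr (xi k @^-1` A k) * Pr (idx k @^-1` B k)))%E.

Definition past_cylinder n (A : nat -> set T) (B : nat -> set 'I_b) : set Omega :=
  \bigcap_(k in [set k | (1 <= k <= n)%N]) (xi k @^-1` A k `&` idx k @^-1` B k).

(** A pi-system containing the whole space; it generates the sigma-algebra of the first [n] samples
    and indices. *)
Definition past_sets n : set (set Omega) :=
  [set C | exists A B, (forall k, measurable (A k)) /\ C = past_cylinder n A B].

Lemma idx_measurable k (B : set 'I_b) : (1 <= k)%N -> measurable (idx k @^-1` B).
Proof.
move=> k1; rewrite (_ : _ @^-1` _ = \bigcup_(i in B) idx k @^-1` [set i]).
  by apply: fin_bigcup_measurable => // i _; exact: idx_meas.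
by apply/seteqP; split => [z Bz|z [i Bi /= ->]//]; exists (idx k z).
Qed.

Lemma past_measurable n : past_sets n `<=` measurable.
Proof.
move=> _ [A [B [mA ->]]]; apply: bigcap_measurableType => k /andP[k1 _].
apply: measurableI; last exact: idx_measurable.
by rewrite -[X in measurable X]setTI; exact: xi_meas.
Qed.

Lemma past_setT n : past_sets n setT.
Proof.
exists (fun=> setT), (fun=> setT); split=> //.
by apply/esym/seteqP; split.
Qed.

Lemma past_setI n : setI_closed (past_sets n).
Proof.
move=> _ _ [A1 [B1 [mA1 ->]]] [A2 [B2 [mA2 ->]]].
exists (fun k => A1 k `&` A2 k), (fun k => B1 k `&` B2 k); split.
  by move=> k; exact: measurableI.
apply/seteqP; split=> [z [h1 h2] k kn|z h].
  by have [? ?] := h1 _ kn; have [? ?] := h2 _ kn.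
by split => k kn; have [[? ?] [? ?]] := h _ kn.
Qed.

(** A cylinder of length [n] cut by a condition at time [n.+1] is a cylinder of length [n.+1], so
    the product formula [indep] evaluates both probabilities. *)
Lemma past_indep_cylinder n C A i : past_sets n C -> measurable A ->
  Pr (C `&` (xi n.+1 @^-1` A `&` idx n.+1 @^-1` [set i])) =
  (Pr C * (mu A * (p i)%:E))%E.
Proof.
move=> [A1 [B1 [mA1 ->]]] mA.
pose A2 k := if k == n.+1 then A else A1 k.
pose B2 k := if k == n.+1 then [set i] else B1 k.
rewrite (_ : _ `&` _ = past_cylinder n.+1 A2 B2); last first.
  apply/seteqP; split=> [z [h1 h2] k /= /andP[k1 kn]|z h].
    rewrite /A2 /B2; case: eqVneq => [->//|kN].
    by apply: h1; rewrite /= k1 -ltnS ltn_neqAle kN.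
  split; last by have := h n.+1; rewrite /A2 /B2 eqxx; apply => /=; rewrite leqnn.
  move=> k /= /andP[k1 kn]; have := h k; rewrite /A2 /B2.
  by rewrite ltn_eqF ?ltnS//; apply; rewrite /= k1 leqW.
rewrite !indep//; last by move=> k; rewrite /A2; case: ifP.
rewrite big_nat_recr//= /A2 /B2 !eqxx xi_law// idx_law//; congr (_ * _)%E.
rewrite big_nat_cond [in RHS]big_nat_cond; apply: eq_bigr => k /andP[/andP[_ kn] _].
by rewrite ltn_eqF.
Qed.

(** Both sides are finite measures in [C] that agree on the pi-system of cylinders, hence on the
    sigma-algebra it generates. *)
Lemma past_indep n C A i : <<s past_sets n >> C -> measurable A ->
  Pr (C `&` (xi n.+1 @^-1` A `&` idx n.+1 @^-1` [set i])) =
  (Pr C * (mu A * (p i)%:E))%E.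
Proof.
move=> sC mA.
have mD : measurable (xi n.+1 @^-1` A `&` idx n.+1 @^-1` [set i]).
  apply: measurableI; last exact: idx_measurable.
  by rewrite -[X in measurable X]setTI; exact: xi_meas.
have c0 : 0 <= fine (mu A) * p i by rewrite mulr_ge0 ?fine_ge0// ltW.
have cE : (mu A * (p i)%:E = (fine (mu A) * p i)%:E)%E.
  by rewrite EFinM fineK// fin_num_measure.
rewrite cE muleC.
pose m1 : {measure set Omega -> \bar R} := mrestr Pr mD.
pose m2 : {measure set Omega -> \bar R} := mscale (NngNum c0) Pr.
have m12 B : past_sets n B -> m1 B = m2 B.
  by move=> nB; rewrite [LHS]past_indep_cylinder// cE muleC.
have m1_fin (_ : nat) : (m1 setT < +oo)%E.
  rewrite (le_lt_trans (_ : _ <= 1)%E) ?ltry//.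
  by rewrite [leLHS]/(Pr (setT `&` _)) setTI probability_le1.
have cover : \bigcup_(_ : nat) [set: Omega] = setT.
  by apply/seteqP; split => // z _; exists 0%N.
exact: (@g_sigma_algebra_measure_unique _ R Omega (past_sets n) (@past_measurable n)
  (fun=> setT) (fun=> past_setT n) cover m1 m2 (@past_setI n) m12 m1_fin C sC).
Qed.

Lemma past_id_measurable n :
  measurable_fun setT (id : Omega -> g_sigma_algebraType (past_sets n)).
Proof.
move=> _ B sB; rewrite setTI preimage_id.
apply: smallest_sub sB; first exact: sigma_algebra_measurable.
exact: past_measurable.
Qed.

Lemma past_xi_measurable n k : (1 <= k <= n)%N ->
  measurable_fun setT (xi k : g_sigma_algebraType (past_sets n) -> T).
Proof.
move=> kn _ A mA; rewrite setTI; apply: sub_sigma_algebra.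
exists (fun j => if j == k then A else setT), (fun=> setT); split.
  by move=> j; case: ifP.
apply/seteqP; split=> [z Az j _ /=|z /(_ _ kn)/=]; last by rewrite eqxx => -[].
by split => //; case: eqP => // ->.
Qed.

Lemma past_idx_measurable n k i : (1 <= k <= n)%N ->
  measurable (idx k @^-1` [set i] : set (g_sigma_algebraType (past_sets n))).
Proof.
move=> kn; apply: sub_sigma_algebra.
exists (fun=> setT), (fun j => if j == k then [set i] else setT); split => //.
apply/seteqP; split=> [z Az j _ /=|z /(_ _ kn)/=]; last by rewrite eqxx => -[].
by split => //; case: eqP => // ->.
Qed.

(** Takes the place of conditioning on the past: the fresh sample is integrated out against [mu],
    and the event [idx n.+1 = i] contributes its probability. *)
Lemma past_tonelli n i (q : g_sigma_algebraType (past_sets n) * T -> \bar R) :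
  measurable_fun setT q -> (forall x, 0 <= q x)%E ->
  (\int[Pr]_(z in idx n.+1 @^-1` [set i]) q (z, xi n.+1 z) =
   (p i)%:E * \int[Pr]_z \int[mu]_t q (z, t))%E.
Proof.
move=> mq q0; apply: (indep_tonelli (@past_id_measurable n)) => //.
- exact: xi_meas.
- exact: idx_measurable.
- by move=> A B sA mB; exact: past_indep.
Qed.

End Past.

(** * Weighted averages of the iterates, and the block decomposition *)

Section WeightedAverage.
Context {R : realType}.

Lemma sum_nat_gt0 (gam : nat -> R) n : (forall k, (1 <= k <= n.+1)%N -> 0 < gam k) ->
  0 < \sum_(1 <= k < n.+2) gam k.
Proof.
move=> g0; rewrite big_nat_recr//=; apply: ltr_wpDl; last by apply: g0; rewrite leqnn.
rewrite big_nat_cond; apply: sumr_ge0 => k /andP[/andP[k1 kn] _].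
by apply/ltW/g0; rewrite k1 leqW// ltnW.
Qed.

Lemma cvx_set_average m (A : set 'rV[R]_m) (gam : nat -> R) (u : nat -> 'rV[R]_m) n :
  cvx_set A -> (forall k, (1 <= k <= n.+1)%N -> 0 < gam k) ->
  (forall k, (1 <= k <= n.+1)%N -> A (u k)) ->
  A ((\sum_(1 <= k < n.+2) gam k)^-1 *: \sum_(1 <= k < n.+2) gam k *: u k).
Proof.
move=> cA; elim: n => [|n IH] g0 Au.
  rewrite !big_nat1 scalerA mulVf ?scale1r; first exact: Au.
  by rewrite gt_eqF// g0.
set S := \sum_(1 <= k < n.+2) gam k.
have S0 : 0 < S.
  by apply: sum_nat_gt0 => k /andP[k1 kn]; apply: g0; rewrite k1 leqW.
have gn0 : 0 < gam n.+2 by apply: g0; rewrite leqnn.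
have Au' : A (S^-1 *: \sum_(1 <= k < n.+2) gam k *: u k).
  by apply: IH => k /andP[k1 kn]; [apply: g0|apply: Au]; rewrite k1 leqW.
rewrite [X in X^-1](big_nat_recr n.+2)//= -/S [X in _ *: X](big_nat_recr n.+2)//=.
set U := \sum_(1 <= k < n.+2) gam k *: u k.
(* The longer average is a convex combination of the shorter one and the new point. *)
rewrite (_ : _ *: (_ + _) = (S / (S + gam n.+2)) *: (S^-1 *: U) +
    (1 - S / (S + gam n.+2)) *: u n.+2).
  apply: cA => //; first by apply: Au; rewrite leqnn.
  apply/andP; split; first by rewrite divr_ge0 ?ltW// addr_gt0.
  by rewrite ler_pdivrMr ?addr_gt0// mul1r lerDl ltW.
rewrite scalerDr !scalerA; congr (_ *: _ + _ *: _).
  by field; rewrite !gt_eqF ?addr_gt0.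
by field; rewrite !gt_eqF ?addr_gt0.
Qed.

(* Jensen's inequality for the average is read off from a subgradient at the average. *)
Lemma subgradient_average m (A : set 'rV[R]_m) (f : 'rV[R]_m -> R)
    (g : 'rV[R]_m -> 'rV[R]_m) (gam : nat -> R) (u : nat -> 'rV[R]_m) x n :
  cvx_set A -> (forall y z, A y -> A z -> f z >= f y + dotv (g y) (z - y)) ->
  (forall k, (1 <= k <= n.+1)%N -> 0 < gam k) ->
  (forall k, (1 <= k <= n.+1)%N -> A (u k)) -> A x ->
  f ((\sum_(1 <= k < n.+2) gam k)^-1 *: \sum_(1 <= k < n.+2) gam k *: u k) - f x <=
  (\sum_(1 <= k < n.+2) gam k)^-1 *
    \sum_(1 <= k < n.+2) gam k * dotv (g (u k)) (u k - x).
Proof.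
move=> cA sg g0 Au Ax; have := cvx_set_average cA g0 Au.
set S := \sum_(1 <= k < n.+2) gam k; set v := _ *: _ => Av.
have S0 : 0 < S by exact: sum_nat_gt0.
rewrite mulrC ler_pdivlMr// mulrC mulr_suml.
(* Weighted deviations from the average [v] sum to zero, so the subgradient terms at [v] may be
   added to the left side at no cost. *)
have Sv : \sum_(1 <= k < n.+2) gam k * dotv (g v) (u k - v) = 0.
  rewrite (eq_bigr (fun k => dotv (g v) (gam k *: u k) - gam k * dotv (g v) v)).
    rewrite sumrB -dotv_sumr -mulr_suml -/S -dotvZr -dotvBr /v scalerA.
    by rewrite mulfV ?gt_eqF// scale1r subrr dotv0.
  by move=> k _; rewrite dotvBr dotvZr mulrBr.
rewrite -[leLHS]addr0 -[X in _ + X <= _]Sv -big_split /=.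
rewrite big_nat_cond [leRHS]big_nat_cond; apply: ler_sum => k /andP[kn _].
rewrite -mulrDr; apply: ler_wpM2l; first exact/ltW/g0.
have := sg _ _ (Au k kn) Ax; have := sg _ _ Av (Au k kn).
by rewrite !dotvBr; lra.
Qed.

Context {b : nat} {ni : 'I_b -> nat}.

Lemma dotv_blocks (y u : 'rV[R]_(\sum_(i < b) ni i)) :
  dotv y u = \sum_(i < b) dotv (submxrow y i) (submxrow u i).
Proof.
have mulE m (v w : 'rV[R]_m) : dotv v w = (v *m w^T) ord0 ord0.
  by rewrite mxE; apply: eq_bigr => j _; rewrite mxE.
rewrite mulE -[in LHS](submxrowK y) -[in LHS](submxrowK u) tr_mxrow mul_mxrow_mxcol.
by rewrite summxE; apply: eq_bigr => i _; rewrite mulE.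
Qed.

Lemma submxrowZ (a : R) (y : 'rV[R]_(\sum_(i < b) ni i)) i :
  submxrow (a *: y) i = a *: submxrow y i.
Proof. by apply/rowP => j; rewrite !mxE. Qed.

Lemma cvx_prod_set (Xs : forall i : 'I_b, set 'rV[R]_(ni i)) :
  (forall i, cvx_set (Xs i)) -> cvx_set (prod_set Xs).
Proof.
by move=> cX x y t Xx Xy t01 i; rewrite submxrowD !submxrowZ; apply: cX.
Qed.

End WeightedAverage.

(** * Monotonicity, parameters and finite sums under the integral *)

Section Integral.
Context {R : realType} {d : measure_display} {S : measurableType d}.
Local Open Scope ereal_scope.

(* Neither function needs to be measurable: the integral of a nonnegative function
   is a supremum over simple functions below it. *)
Lemma le_integral_pointwise (m : {measure set S -> \bar R}) (f1 f2 : S -> \bar R) :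
  (forall z, f1 z <= f2 z) -> \int[m]_z f1 z <= \int[m]_z f2 z.
Proof.
move=> f12.
have ge0_le (h1 h2 : S -> \bar R) : (forall z, 0 <= h1 z) -> (forall z, h1 z <= h2 z) ->
    \int[m]_z h1 z <= \int[m]_z h2 z.
  move=> h10 h12; rewrite !ge0_integralTE//; last first.
    by move=> z; rewrite (le_trans (h10 z)).
  apply: le_ereal_sup => _ [h /= hh1 <-]; exists h => //= z.
  by rewrite (le_trans (hh1 z)).
rewrite integralE [leRHS]integralE; apply: leeB; apply: ge0_le => z //.
- by apply: (@funepos_le _ _ setT); rewrite ?inE.
- by apply: (@funeneg_le _ _ setT); rewrite ?inE.
Qed.

(** Used to see that [g], known on X only as the mean of [G], is measurable along the iterates. *)
Lemma measurable_integral_param d' (T : measurableType d') (mu : probability T R)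
    (q : S * T -> \bar R) : measurable_fun setT q ->
  measurable_fun setT (fun z => \int[mu]_t q (z, t)).
Proof.
move=> mq; rewrite (_ : (fun z => _) =
    (fun z => fubini_F mu q^\+ z - fubini_F mu q^\- z)); last first.
  apply/funext => z; rewrite integralE.
  by congr (_ - _); apply: eq_integral => t _; rewrite ?funeposE ?funenegE.
apply: emeasurable_funB; apply: measurable_fun_fubini_tonelli_F => //.
- exact: measurable_funepos.
- exact: measurable_funeneg.
Qed.

End Integral.

Section IntegralOfSums.
Context {R : realType} {d : measure_display} {S : measurableType d}.
Context {m : {measure set S -> \bar R}}.

Lemma integrable_Rintegral_sum (I : eqType) (s : seq I) (h : I -> S -> R) :
  (forall k, k \in s -> m.-integrable setT (EFin \o h k)) ->
  m.-integrable setT (EFin \o (fun z => \sum_(k <- s) h k z)) /\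
  \int[m]_z (\sum_(k <- s) h k z) = \sum_(k <- s) \int[m]_z h k z.
Proof.
elim: s => [|k s IH] hint.
  rewrite big_nil; under eq_fun do rewrite big_nil; split; last first.
    by rewrite /Rintegral integral0.
  exact: integrable0.
have [|si sE] := IH; first by move=> j js; apply: hint; rewrite inE js orbT.
have ki : m.-integrable setT (EFin \o h k) by apply: hint; rewrite inE eqxx.
have -> : (fun z => \sum_(j <- k :: s) h j z) = (fun z => h k z + \sum_(j <- s) h j z).
  by apply/funext => z; rewrite big_cons.
split; last by rewrite RintegralD// sE big_cons.
exact: (integrableD measurableT ki si).
Qed.

Lemma EFin_Rintegral (h : S -> R) : m.-integrable setT (EFin \o h) ->
  (\int[m]_z h z)%:E = (\int[m]_z (h z)%:E)%E.
Proof. by move=> hi; rewrite /Rintegral fineK// (integrable_fin_num measurableT hi). Qed.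

Lemma ge0_integrable (h : S -> R) : measurable_fun setT h -> (forall z, 0 <= h z) ->
  (\int[m]_z (h z)%:E < +oo)%E -> m.-integrable setT (EFin \o h).
Proof.
move=> mh h0 hoo; apply/integrableP; split; first exact/measurable_EFinP.
by under eq_integral do rewrite /= ger0_norm//.
Qed.

Lemma integrable_dotv n (v : S -> 'rV[R]_n) (u d0 : 'rV[R]_n) :
  (forall j, m.-integrable setT (fun z => (v z ord0 j)%:E) /\
     (u ord0 j)%:E = (\int[m]_z (v z ord0 j)%:E)%E) ->
  m.-integrable setT (EFin \o (fun z => dotv (v z) d0)) /\
  \int[m]_z dotv (v z) d0 = dotv u d0.
Proof.
move=> vu.
have vi j : m.-integrable setT (EFin \o (fun z => v z ord0 j)) by case: (vu j).
have [|si sE] := @integrable_Rintegral_sum 'I_n (index_enum 'I_n)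
    (fun j z => v z ord0 j * d0 ord0 j).
  move=> j _; have := integrableZl measurableT (d0 ord0 j) (vi j).
  by apply: eq_integrable => // z _ /=; rewrite -EFinM mulrC.
split=> //; rewrite sE; apply: eq_bigr => j _.
rewrite RintegralZr//; congr (_ * _); apply: EFin_inj.
by rewrite EFin_Rintegral//; case: (vu j) => _ ->.
Qed.

End IntegralOfSums.

Unset Implicit Arguments.

(** * The recursion for one block and its telescoping *)

Section SBMD.
Context {R : realType} {b : nat} {ni : 'I_b -> nat}.
Local Notation vec := 'rV[R]_(\sum_(i < b) ni i).
Context {Xs : forall i : 'I_b, set 'rV[R]_(ni i)}.
Hypothesis Xcvx : forall i, cvx_set (Xs i).
Context {nrm : forall i : 'I_b, 'rV[R]_(ni i) -> R}.
Hypothesis nrmP : forall i, is_norm (nrm i).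
Context {omega : forall i : 'I_b, 'rV[R]_(ni i) -> R}.
Context {domega : forall i : 'I_b, 'rV[R]_(ni i) -> 'rV[R]_(ni i)}.
Hypothesis omega_diff : forall i z, Xs i z ->
  differentiable (omega i) z /\ forall u, 'd (omega i) z u = dotv (domega i z) u.
Hypothesis omega_C1 : forall i, {within Xs i, continuous (domega i)}.
Hypothesis omega_sc : forall i (x z : 'rV[R]_(ni i)), Xs i x -> Xs i z ->
  dotv (x - z) (domega i x - domega i z) >= nrm i (x - z) ^+ 2.
Context {P : forall i : 'I_b, 'rV[R]_(ni i) -> 'rV[R]_(ni i) -> R -> 'rV[R]_(ni i)}.
Hypothesis Pmin : forall i (v y : 'rV[R]_(ni i)) (gam : R), Xs i v -> 0 < gam ->
  is_argmin (Xs i) (prox_obj (omega i) (domega i) v y gam) (P i v y gam).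
Context {dT : measure_display} {T : measurableType dT} {mu : probability T R}.
Context {G : vec -> T -> vec} {g : vec -> vec}.
Hypothesis G_meas : forall j, jointly_measurable (fun xt => G xt.1 xt.2 ord0 j).
Hypothesis GP : forall x, prod_set Xs x -> forall j,
  mu.-integrable setT (fun t => (G x t ord0 j)%:E) /\
  (g x ord0 j)%:E = (\int[mu]_t (G x t ord0 j)%:E)%E.
Context {M : 'I_b -> R}.
Hypothesis GM : forall x i, prod_set Xs x ->
  (\int[mu]_t ((dual_norm (nrm i) (submxrow (G x t) i)) ^+ 2)%:E <= (M i ^+ 2)%:E)%E.

Set Implicit Arguments.

Section Measurability.
Context {dS : measure_display} {S : measurableType dS}.

Lemma measurable_prox i (v y : S -> 'rV[R]_(ni i)) (gam : R) : 0 < gam ->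
  (forall z, Xs i (v z)) -> rV_measurable v -> rV_measurable y ->
  rV_measurable (fun z => P i (v z) (y z) gam).
Proof.
move=> g0 Xv mv my.
have [L L0 PL] := argmin_lip (Xcvx i) (nrmP i) (omega_diff i) (omega_sc i).
apply: (@rV_measurable_lip _ _ _ _ _ L (fun z => gam *: y z - domega i (v z))) => //.
  by move=> z z'; apply: PL; apply: prox_argmin => //; exact: Pmin.
apply: rV_measurableB; first exact: rV_measurableZ.
exact: (rV_measurable_within (omega_C1 i)).
Qed.

Lemma measurable_bregman i (v : S -> 'rV[R]_(ni i)) x : (forall z, Xs i (v z)) ->
  rV_measurable v -> measurable_fun setT (fun z => bregman (omega i) (domega i) (v z) x).
Proof.
move=> Xv mv; apply: measurable_funB; first apply: measurable_funB.
- exact: measurable_cst.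
- apply: (measurable_fun_within (A := Xs i)) => //.
  apply: continuous_in_subspaceT => z /set_mem Xz.
  exact: differentiable_continuous (omega_diff i z Xz).1.
apply: measurable_dotv; first exact: (rV_measurable_within (omega_C1 i)).
by apply: rV_measurableB => //; exact: rV_measurable_cst.
Qed.

End Measurability.

Lemma sbmd_iter_in (gam : nat -> R) (x1 : vec) (xis : nat -> T) (ids : nat -> 'I_b) n :
  prod_set Xs x1 -> (forall k, (1 <= k <= n)%N -> 0 < gam k) ->
  prod_set Xs (sbmd_iter P G gam x1 xis ids n.+1).
Proof.
move=> Xx1; elim: n => // n IH g0 i.
have {}IH := IH (fun k kn => g0 k ltac:(by case/andP: kn => -> /leqW)).
rewrite [sbmd_iter _ _ _ _ _ _ _]/= -/(sbmd_iter P G gam x1 xis ids n.+1) mxrowK.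
case: eqP => [_|_]; last exact: IH.
by case: (Pmin i _ (submxrow (G (sbmd_iter P G gam x1 xis ids n.+1) (xis n.+1)) i)
  (gam n.+1) (IH i) (g0 n.+1 ltac:(by rewrite /= leqnn))).
Qed.

(** Stated over any [S] because it is applied twice: on [Omega], and on [Omega] with the
    sigma-algebra of the first [n] samples and indices, where it says that the iterate is determined
    by the past. *)
Lemma measurable_sbmd_iter dS (S : measurableType dS) (gam : nat -> R) (x1 : vec)
    (xis : nat -> S -> T) (ids : nat -> S -> 'I_b) n :
  prod_set Xs x1 -> (forall k, (1 <= k <= n)%N -> 0 < gam k) ->
  (forall k, (1 <= k <= n)%N -> measurable_fun setT (xis k)) ->
  (forall k i, (1 <= k <= n)%N -> measurable (ids k @^-1` [set i])) ->
  rV_measurable (fun z => sbmd_iter P G gam x1 (xis ^~ z) (ids ^~ z) n.+1).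
Proof.
move=> Xx1; elim: n => [|n IH] g0 mxi mid; first exact: rV_measurable_cst.
have kS k : (1 <= k <= n -> 1 <= k <= n.+1)%N by case/andP => -> /leqW.
have {}IH := IH (fun k kn => g0 k (kS k kn)) (fun k kn => mxi k (kS k kn))
  (fun k i kn => mid k i (kS k kn)).
have nn : (1 <= n.+1 <= n.+1)%N by rewrite /= leqnn.
set y := fun z => sbmd_iter P G gam x1 (xis ^~ z) (ids ^~ z) n.+1 in IH.
have mG : rV_measurable (fun z => G (y z) (xis n.+1 z)).
  by move=> j; exact: (jointly_measurable_comp IH (mxi _ nn) (G_meas j)).
have Xy z : prod_set Xs (y z).
  by apply: sbmd_iter_in => // k /kS; exact: g0.
apply: (rV_measurable_mxrow (s := fun i z => if i == ids n.+1 z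
  then P i (submxrow (y z) i) (submxrow (G (y z) (xis n.+1 z)) i) (gam n.+1)
  else submxrow (y z) i)) => i j.
rewrite (_ : (fun _ => _) = fun z => if i == ids n.+1 z
  then P i (submxrow (y z) i) (submxrow (G (y z) (xis n.+1 z)) i) (gam n.+1) ord0 j
  else submxrow (y z) i ord0 j); last by apply/funext => z; case: ifP.
apply: measurable_fun_ifT.
- apply: (measurable_fun_bool true); rewrite setTI.
  rewrite (_ : _ @^-1` _ = ids n.+1 @^-1` [set i]); first exact: mid.
  by apply/seteqP; split=> z /= => [/eqP ->|->]; rewrite ?eqxx.
- apply: measurable_prox; [exact: g0|by move=> z; exact: Xy| |];
    exact: rV_measurable_submxrow.
- exact: rV_measurable_submxrow.
Qed.

Context {x : vec}.
Hypothesis Xx : prod_set Xs x.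

Definition block_div i (y : vec) :=
  bregman (omega i) (domega i) (submxrow y i) (submxrow x i).

Definition block_gain i (gam : R) (y : vec) :=
  gam * dotv (submxrow (g y) i) (submxrow y i - submxrow x i).

(** Right-hand side of [prox_three_point] for the oracle value [v]. *)
Definition block_bound i (gam : R) (y v : vec) :=
  block_div i y + gam * dotv (submxrow v i) (submxrow x i - submxrow y i)
  + 2^-1 * (gam ^+ 2 * dual_norm (nrm i) (submxrow v i) ^+ 2).

Lemma block_div_ge0 i y : prod_set Xs y -> 0 <= block_div i y.
Proof.
move=> Xy; apply: le_trans (bregman_ge (Xcvx i) (nrmP i) (omega_diff i) (omega_sc i) (Xy i) (Xx i)).
by apply: mulr_ge0 => //; exact: sqr_ge0.
Qed.

Lemma block_bound_ge0 i gam y v : prod_set Xs y -> 0 <= block_bound i gam y v.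
Proof. move=> Xy.
exact: (prox_bound_ge0 (Xcvx i) (nrmP i) (omega_diff i) (omega_sc i) _ _ (Xy i) (Xx i)). Qed.

Lemma measurable_block_div dS (S : measurableType dS) (y : S -> vec) i :
  rV_measurable y -> (forall z, prod_set Xs (y z)) ->
  measurable_fun setT (block_div i \o y).
Proof.
move=> my Xy; apply: (@measurable_bregman _ _ i (fun z => submxrow (y z) i)) => //.
  by move=> z; exact: Xy.
exact: rV_measurable_submxrow.
Qed.

Lemma measurable_block_bound dS (S : measurableType dS) (y : S -> vec) i gam :
  rV_measurable y -> (forall z, prod_set Xs (y z)) ->
  measurable_fun setT (fun zt : S * T => block_bound i gam (y zt.1) (G (y zt.1) zt.2)).
Proof.
move=> my Xy.
have my1 : rV_measurable (fun zt : S * T => y zt.1).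
  by move=> j; exact: (measurableT_comp (my j) measurable_fst).
have mG : rV_measurable (fun zt : S * T => G (y zt.1) zt.2).
  by move=> j; exact: (jointly_measurable_comp my1 measurable_snd (G_meas j)).
have mGi := rV_measurable_submxrow (i := i) mG.
apply: measurable_funD; first apply: measurable_funD.
- by apply: measurable_block_div => // zt; exact: Xy.
- apply: measurable_funM => //; apply: measurable_dotv => //.
  apply: rV_measurableB; first exact: rV_measurable_cst.
  exact: rV_measurable_submxrow.
apply: measurable_funM => //; apply: measurable_funM => //.
by apply: measurable_funX; exact: measurable_dual_norm.
Qed.

Lemma measurable_block_gain dS (S : measurableType dS) (y : S -> vec) i gam :
  rV_measurable y -> (forall z, prod_set Xs (y z)) ->
  measurable_fun setT (block_gain i gam \o y).
Proof.
move=> my Xy.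
have my1 : rV_measurable (fun zt : S * T => y zt.1).
  by move=> j; exact: (measurableT_comp (my j) measurable_fst).
have mg : rV_measurable (g \o y).
  move=> j; apply/measurable_EFinP.
  rewrite (_ : _ \o _ = fun z => \int[mu]_t (G (y z) t ord0 j)%:E)%E; last first.
    by apply/funext => z /=; case: (GP _ (Xy z) j).
  apply: (@measurable_integral_param _ _ _ _ _ _ (fun zt => (G (y zt.1) zt.2 ord0 j)%:E)).
  apply/measurable_EFinP.
  exact: (jointly_measurable_comp my1 measurable_snd (G_meas j)).
apply: measurable_funM => //; apply: measurable_dotv.
  exact: (rV_measurable_submxrow (i := i) mg).
apply: rV_measurableB; first exact: rV_measurable_submxrow.
exact: rV_measurable_cst.
Qed.

(** Unbiasedness of [G] turns the linear term into minus the gain, and [GM] bounds the quadratic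
    one; [gam] may have either sign. *)
Lemma integral_block_bound i gam y : prod_set Xs y ->
  (\int[mu]_t (block_bound i gam y (G y t))%:E <=
   (block_div i y - block_gain i gam y + 2^-1 * (gam ^+ 2 * M i ^+ 2))%:E)%E.
Proof.
move=> Xy; set d0 := submxrow x i - submxrow y i.
pose D t := dual_norm (nrm i) (submxrow (G y t) i) ^+ 2.
have mG : rV_measurable (G y).
  by move=> j; have [/measurable_int/measurable_EFinP] := GP _ Xy j.
have Gi j : mu.-integrable setT (fun t => (submxrow (G y t) i ord0 j)%:E) /\
    (submxrow (g y) i ord0 j)%:E = (\int[mu]_t (submxrow (G y t) i ord0 j)%:E)%E.
  rewrite mxE (_ : (fun t => _) = fun t => (G y t ord0 (tagnat.Rank i j))%:E).
    exact: GP.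
  by apply/funext => t; rewrite mxE.
have [Li LE] := integrable_dotv d0 Gi.
have Di : mu.-integrable setT (EFin \o D).
  apply: ge0_integrable; last exact: le_lt_trans (GM _ i Xy) (ltry _).
    by apply: measurable_funX; apply: measurable_dual_norm => //; exact: rV_measurable_submxrow.
  by move=> t; exact: sqr_ge0.
have DM : \int[mu]_t D t <= M i ^+ 2 by rewrite -lee_fin EFin_Rintegral//; exact: GM.
have Ci : mu.-integrable setT (EFin \o (fun=> block_div i y)).
  exact: finite_measure_integrable_cst.
have gLi : mu.-integrable setT (EFin \o (fun t => gam * dotv (submxrow (G y t) i) d0)).
  by have := integrableZl measurableT gam Li; apply: eq_integrable => // t _ /=; rewrite -EFinM.
have gDi : mu.-integrable setT (EFin \o (fun t => 2^-1 * (gam ^+ 2 * D t))).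
  have := integrableZl measurableT (2^-1 * gam ^+ 2) Di.
  by apply: eq_integrable => // t _; congr EFin; rewrite [RHS]mulrA.
have CLi : mu.-integrable setT (EFin \o
    (fun t => block_div i y + gam * dotv (submxrow (G y t) i) d0)).
  exact: (integrableD measurableT Ci gLi).
rewrite -EFin_Rintegral; last exact: (integrableD measurableT CLi gDi).
rewrite lee_fin RintegralD// RintegralD// RintegralZl// LE.
have -> : \int[mu]_t (2^-1 * (gam ^+ 2 * D t)) = 2^-1 * (gam ^+ 2 * \int[mu]_t D t).
  by rewrite [RHS]mulrA -RintegralZl//; apply: eq_Rintegral => t _; rewrite [LHS]mulrA.
have -> : \int[mu]_t block_div i y = block_div i y.
  rewrite -[RHS]mulr1 -[X in _ * X](congr1 (@fine R) (probability_setT mu)).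
  exact: Rintegral_cst.
apply: lerD.
  by rewrite /block_gain /d0 !dotvBr; lra.
by rewrite ler_wpM2l// ler_wpM2l// sqr_ge0.
Qed.

(** The mean of [block_bound] is nonnegative and at most the value in [integral_block_bound], which
    bounds the gain from above; the same with [- gam] bounds it from below. *)
Lemma block_gain_le i gam y : prod_set Xs y ->
  `|block_gain i gam y| <= block_div i y + 2^-1 * (gam ^+ 2 * M i ^+ 2).
Proof.
move=> Xy.
have le_gam a : block_gain i a y <= block_div i y + 2^-1 * (a ^+ 2 * M i ^+ 2).
  have : (0 <= \int[mu]_t (block_bound i a y (G y t))%:E)%E.
    by apply: integral_ge0 => t _; rewrite lee_fin block_bound_ge0.
  move=> /le_trans/(_ (integral_block_bound i a Xy)).
  by rewrite lee_fin; lra.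
rewrite ler_norml lerNl le_gam andbT -[in leRHS]sqrrN.
by have := le_gam (- gam); rewrite /block_gain mulNr.
Qed.


Context {dO : measure_display} {Omega : measurableType dO} {Pr : probability Omega R}.
Context {xi : nat -> Omega -> T} {idx : nat -> Omega -> 'I_b} {p : 'I_b -> R}.
Hypothesis p_gt0 : forall i, 0 < p i.
Hypothesis xi_meas : forall k, (1 <= k)%N -> measurable_fun setT (xi k).
Hypothesis xi_law : forall k, (1 <= k)%N -> forall A, measurable A ->
  Pr (xi k @^-1` A) = mu A.
Hypothesis idx_meas : forall k, (1 <= k)%N -> forall i, measurable (idx k @^-1` [set i]).
Hypothesis idx_law : forall k, (1 <= k)%N -> forall i, Pr (idx k @^-1` [set i]) = (p i)%:E.
Hypothesis indep : forall (n : nat) (A : nat -> set T) (B : nat -> set 'I_b),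
  (forall k, measurable (A k)) ->
  Pr (\bigcap_(k in [set k | (1 <= k <= n)%N])
        (xi k @^-1` A k `&` idx k @^-1` B k)) =
  (\prod_(1 <= k < n.+1) (Pr (xi k @^-1` A k) * Pr (idx k @^-1` B k)))%E.
Context {gam : nat -> R} {N : nat} {x1 : vec}.
Hypothesis gam_gt0 : forall k, (1 <= k <= N)%N -> 0 < gam k.
Hypothesis Xx1 : prod_set Xs x1.

(** [it n.+1] is x_{n+1}, built from samples and indices 1 to n only. *)
Let it n w := sbmd_iter P G gam x1 (xi ^~ w) (idx ^~ w) n.

Let it_in n w : (n <= N)%N -> prod_set Xs (it n.+1 w).
Proof.
move=> nN; apply: sbmd_iter_in => // k /andP[k1 kn].
by apply: gam_gt0; rewrite k1 (leq_trans kn).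
Qed.

Let it_meas n : (n <= N)%N -> rV_measurable (it n.+1).
Proof.
move=> nN; apply: measurable_sbmd_iter => // [k|k|k i] /andP[k1 kn].
- by apply: gam_gt0; rewrite k1 (leq_trans kn).
- exact: xi_meas.
- exact: idx_meas.
Qed.

Let it_past_meas n : (n <= N)%N ->
  rV_measurable (it n.+1 : g_sigma_algebraType (past_sets (xi := xi) (idx := idx) n) -> _).
Proof.
move=> nN; apply: measurable_sbmd_iter => // [k|k|k i] kn.
- by case/andP: kn => k1 kn; apply: gam_gt0; rewrite k1 (leq_trans kn).
- exact: past_xi_measurable.
- exact: past_idx_measurable.
Qed.

Let var_term i k := 2^-1 * (gam k ^+ 2 * M i ^+ 2).

Let integrable_div i n := Pr.-integrable setT (EFin \o (block_div i \o it n.+1)).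

Lemma block_div_step i n w : (n < N)%N -> idx n.+1 w = i ->
  block_div i (it n.+2 w) <=
  block_bound i (gam n.+1) (it n.+1 w) (G (it n.+1 w) (xi n.+1 w)).
Proof.
move=> nN idxE; have Xy := it_in w (ltnW nN).
rewrite /block_div /it [sbmd_iter _ _ _ _ _ _ _]/= mxrowK -idxE eqxx idxE.
apply: (prox_three_point (Xcvx i) (nrmP i) (omega_diff i) (omega_sc i)) => //.
- exact: gam_gt0.
- by apply: Pmin; [exact: Xy|exact: gam_gt0].
Qed.

Lemma block_div_unchanged i n w : idx n.+1 w <> i ->
  block_div i (it n.+2 w) = block_div i (it n.+1 w).
Proof.
move=> idxN; rewrite /block_div /it [sbmd_iter _ _ _ _ _ _ n.+2]/= mxrowK.
by case: eqP => // iE; case: idxN.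
Qed.

Lemma integrable_block_gain i n : (n < N)%N -> integrable_div i n ->
  Pr.-integrable setT (EFin \o (block_gain i (gam n.+1) \o it n.+1)).
Proof.
move=> nN Vi; have Ci : Pr.-integrable setT (EFin \o (fun=> var_term i n.+1)).
  exact: finite_measure_integrable_cst.
apply: le_integrable (integrableD measurableT Vi Ci) => //.
  apply/measurable_EFinP; apply: measurable_block_gain; first exact: (it_meas (ltnW nN)).
  by move=> w; exact: it_in (ltnW nN).
move=> w _; rewrite /= lee_fin.
have gle := block_gain_le i (gam n.+1) (it_in w (ltnW nN)).
by rewrite (le_trans gle)// ler_norm.
Qed.

(** On [D] the new divergence is at most [block_bound], whose integral over the fresh sample is at
    most [W]; off [D] it is unchanged. Its mean is thus at most [p i * E W + (1 - p i) * E V], a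
    finite number, which yields integrability and the inequality together. *)
Lemma expected_block_step i n : (n < N)%N -> integrable_div i n ->
  integrable_div i n.+1 /\
  \int[Pr]_w block_div i (it n.+2 w) +
    p i * \int[Pr]_w block_gain i (gam n.+1) (it n.+1 w) <=
  \int[Pr]_w block_div i (it n.+1 w) + p i * var_term i n.+1.
Proof.
move=> nN Vi; have nN' := ltnW nN.
pose V w := block_div i (it n.+1 w); pose V' w := block_div i (it n.+2 w).
pose h w := block_gain i (gam n.+1) (it n.+1 w).
pose W w := V w - h w + var_term i n.+1.
pose D := idx n.+1 @^-1` [set i].
have mD : measurable D by exact: idx_meas.
have hi : Pr.-integrable setT (EFin \o h) by exact: integrable_block_gain.
have Ci : Pr.-integrable setT (EFin \o (fun=> var_term i n.+1)).
  exact: finite_measure_integrable_cst.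
have Vhi : Pr.-integrable setT (EFin \o (fun w => V w - h w)).
  exact: (integrableB measurableT Vi hi).
have Wi : Pr.-integrable setT (EFin \o W) by exact: (integrableD measurableT Vhi Ci).
have mV : measurable_fun setT V.
  by apply: measurable_block_div; [exact: it_meas|move=> w; exact: it_in].
have mV' : measurable_fun setT V'.
  by apply: measurable_block_div; [exact: it_meas|move=> w; exact: it_in].
have V0 w : 0 <= V w by apply: block_div_ge0; exact: it_in.
have V'0 w : 0 <= V' w by apply: block_div_ge0; exact: it_in.
have split_D (F : Omega -> R) : measurable_fun setT F -> (forall w, 0 <= F w) ->
    (\int[Pr]_w (F w)%:E = \int[Pr]_(w in D) (F w)%:E + \int[Pr]_(w in ~` D) (F w)%:E)%E.
  move=> mF F0; rewrite -(setUv D) ge0_integral_setU//.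
  - exact: measurableC.
  - by rewrite setUv; exact/measurable_EFinP.
  - by move=> w _; rewrite lee_fin.
  - by rewrite disj_set2E setICr.
have mq := measurable_block_bound i (gam n.+1) (it_past_meas nN') (fun w => it_in w nN').
(* Here [q] ignores the fresh sample, so only the independence of [D] from the past is expressed. *)
have VD : (\int[Pr]_(w in D) (V w)%:E = (p i)%:E * \int[Pr]_w (V w)%:E)%E.
  have := past_tonelli p_gt0 xi_meas xi_law idx_meas idx_law indep i
    (n := n) (q := fun zt => (V zt.1)%:E).
  move=> ->; last by move=> zt; rewrite lee_fin.
    congr (_ * _)%E; apply: eq_integral => w _.
    rewrite -[RHS]mule1 -[X in (_ * X)%E](probability_setT mu).
    exact: (integral_cst mu measurableT (V w)%:E).
  apply/measurable_EFinP; apply: (measurableT_comp _ measurable_fst).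
  by apply: measurable_block_div; [exact: it_past_meas|move=> w; exact: it_in].
have V'D : (\int[Pr]_(w in D) (V' w)%:E <= (p i)%:E * \int[Pr]_w (W w)%:E)%E.
  pose q (zt : g_sigma_algebraType (past_sets (xi := xi) (idx := idx) n) * T) :=
    block_bound i (gam n.+1) (it n.+1 zt.1) (G (it n.+1 zt.1) zt.2).
  have q0 zt : 0 <= q zt by apply: block_bound_ge0; exact: it_in.
  have mqE : measurable_fun setT (EFin \o q) by exact/measurable_EFinP.
  apply: (@le_trans _ _ (\int[Pr]_(w in D) (q (w, xi n.+1 w))%:E)%E).
    apply: ge0_le_integral => //.
    - by move=> w _; rewrite lee_fin.
    - by apply: measurable_funTS; exact/measurable_EFinP.
    - apply: measurable_funTS; apply/measurable_EFinP.
      by apply: (measurableT_comp mq); apply: measurable_fun_pair;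
        [exact: past_id_measurable|exact: xi_meas].
    - by move=> w wD; rewrite lee_fin; exact: block_div_step.
  rewrite (past_tonelli p_gt0 xi_meas xi_law idx_meas idx_law indep i mqE); last first.
    by move=> zt; rewrite lee_fin.
  apply: lee_wpmul2l; first by rewrite lee_fin ltW.
  apply: le_integral_pointwise => w.
  exact: integral_block_bound (it_in w nN').
have V'ND : (\int[Pr]_(w in ~` D) (V' w)%:E = \int[Pr]_(w in ~` D) (V w)%:E)%E.
  by apply: eq_integral => w /set_mem wD; rewrite /V' block_div_unchanged.
have VE := EFin_Rintegral Vi; have WE := EFin_Rintegral Wi.
(* By subtraction from the total, whose finiteness excludes infinite values. *)
have VND : (\int[Pr]_(w in ~` D) (V w)%:E = (\int[Pr]_w V w - p i * \int[Pr]_w V w)%:E)%E.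
  have := split_D V mV V0; rewrite VD -VE -EFinM.
  case: (\int[Pr]_(w in ~` D) (V w)%:E)%E => [r| |] //.
  by rewrite -EFinD => -[vE]; congr EFin; lra.
have WR : \int[Pr]_w W w = \int[Pr]_w V w - \int[Pr]_w h w + var_term i n.+1.
  rewrite RintegralD// RintegralB//; congr (_ + _).
  rewrite -[RHS]mulr1 -[X in _ * X](congr1 (@fine R) (probability_setT Pr)).
  exact: Rintegral_cst.
have V'le : (\int[Pr]_w (V' w)%:E <=
    (p i * \int[Pr]_w W w + (\int[Pr]_w V w - p i * \int[Pr]_w V w))%:E)%E.
  by rewrite split_D// V'ND VND [leRHS]EFinD leeD// EFinM WE.
have V'i : integrable_div i n.+1.
  by apply: ge0_integrable => //; exact: le_lt_trans V'le (ltry _).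
split=> //; move: V'le; rewrite -(EFin_Rintegral V'i) lee_fin WR; lra.
Qed.

Lemma expected_block_gain_sum i :
  (forall k, (1 <= k <= N)%N ->
     Pr.-integrable setT (EFin \o (block_gain i (gam k) \o it k))) /\
  \sum_(1 <= k < N.+1) \int[Pr]_w block_gain i (gam k) (it k w) <=
  (p i)^-1 * block_div i x1 + \sum_(1 <= k < N.+1) var_term i k.
Proof.
(* Integrability is part of the induction because [expected_block_step] consumes it at each step. *)
have tele n : (n <= N)%N -> integrable_div i n /\
    \int[Pr]_w block_div i (it n.+1 w) +
      p i * \sum_(1 <= k < n.+1) \int[Pr]_w block_gain i (gam k) (it k w) <=
    block_div i x1 + p i * \sum_(1 <= k < n.+1) var_term i k.
  elim: n => [_|n IH nN].
    split; first exact: (finite_measure_integrable_cst Pr (block_div i x1) measurableT).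
    rewrite !big_geq// !mulr0 !addr0.
    rewrite -[leRHS]mulr1 -[X in _ <= _ * X](congr1 (@fine R) (probability_setT Pr)).
    by rewrite -(Rintegral_cst Pr measurableT).
  have [Vi IH2] := IH (ltnW nN); have [V'i step] := expected_block_step nN Vi.
  split=> //; rewrite (big_nat_recr n.+1)//= (big_nat_recr n.+1)//=; lra.
split=> [[//|k] /andP[_ kN]|].
  by apply: integrable_block_gain => //; case: (tele k (ltnW kN)).
have [_ teleN] := tele N (leqnn N).
rewrite -(ler_pM2l (p_gt0 i)) mulrDr mulVKf ?gt_eqF//.
(* The last divergence is nonnegative and is dropped. *)
apply: le_trans teleN; rewrite lerDr; apply: Rintegral_ge0 => w _.
by apply: block_div_ge0; exact: it_in.
Qed.

End SBMD.

Theorem theorem2p1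
  (R : realType) (b : nat) (ni : 'I_b -> nat)
  (* blocks X_i: nonempty, closed, convex *)
  (Xs : forall i : 'I_b, set 'rV[R]_(ni i))
  (hXne : forall i, Xs i !=set0)
  (hXcl : forall i, closed (Xs i))
  (hXcv : forall i, cvx_set (Xs i))
  (* norms on each block *)
  (nrm : forall i : 'I_b, 'rV[R]_(ni i) -> R)
  (hnrm : forall i, is_norm (nrm i))
  (* distance generating functions omega_i with gradients domega_i *)
  (omega : forall i : 'I_b, 'rV[R]_(ni i) -> R)
  (domega : forall i : 'I_b, 'rV[R]_(ni i) -> 'rV[R]_(ni i))
  (homega_diff : forall i z, Xs i z ->
      differentiable (omega i) z /\ forall u, 'd (omega i) z u = dotv (domega i z) u)
  (homega_C1 : forall i, {within Xs i, continuous (domega i)})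
  (homega_sc : forall i x z, Xs i x -> Xs i z ->
      dotv (x - z) (domega i x - domega i z) >= nrm i (x - z) ^+ 2)
  (* prox-mappings P_i(v, y, gamma) = argmin_{u in X_i} <y,u> + V_i(v,u)/gamma *)
  (P : forall i : 'I_b, 'rV[R]_(ni i) -> 'rV[R]_(ni i) -> R -> 'rV[R]_(ni i))
  (hP : forall i v y (gam : R), Xs i v -> 0 < gam ->
      is_argmin (Xs i) (prox_obj (omega i) (domega i) v y gam) (P i v y gam))
  (* the random vector xi, with law mu on the measurable space T *)
  (dT : measure_display) (T : measurableType dT) (mu : probability T R)
  (* the objective f(x) = E[F(x, xi)], convex on X *)
  (F : 'rV[R]_(\sum_(i < b) ni i) -> T -> R)
  (f : 'rV[R]_(\sum_(i < b) ni i) -> R)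
  (hFcont : forall t, {within prod_set Xs, continuous (F ^~ t)})
  (hF : forall x, prod_set Xs x ->
      mu.-integrable setT (fun t => (F x t)%:E) /\
      (f x)%:E = (\int[mu]_t (F x t)%:E)%E)
  (hfconv : cvx_on (prod_set Xs) f)
  (* the stochastic oracle G, unbiased for a subgradient g(x) of f *)
  (G : 'rV[R]_(\sum_(i < b) ni i) -> T -> 'rV[R]_(\sum_(i < b) ni i))
  (g : 'rV[R]_(\sum_(i < b) ni i) -> 'rV[R]_(\sum_(i < b) ni i))
  (hGmeas : forall j, jointly_measurable (fun xt => G xt.1 xt.2 ord0 j))
  (hG : forall x, prod_set Xs x -> forall j,
      mu.-integrable setT (fun t => (G x t ord0 j)%:E) /\
      (g x ord0 j)%:E = (\int[mu]_t (G x t ord0 j)%:E)%E)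
  (hgsub : forall x y, prod_set Xs x -> prod_set Xs y ->
      f y >= f x + dotv (g x) (y - x))
  (M : 'I_b -> R)
  (hM : forall x i, prod_set Xs x ->
      (\int[mu]_t ((dual_norm (nrm i) (submxrow (G x t) i)) ^+ 2)%:E
        <= (M i ^+ 2)%:E)%E)
  (* the underlying probability space and the random sequences xi_k, i_k *)
  (dO : measure_display) (Omega : measurableType dO) (Pr : probability Omega R)
  (xi : nat -> Omega -> T) (idx : nat -> Omega -> 'I_b)
  (p : 'I_b -> R) (hp_pos : forall i, 0 < p i) (hp_sum : \sum_(i < b) p i = 1)
  (hxi_meas : forall k, (1 <= k)%N -> measurable_fun setT (xi k))
  (hxi_law : forall k, (1 <= k)%N -> forall A, measurable A ->
      Pr (xi k @^-1` A) = mu A)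
  (hidx_meas : forall k, (1 <= k)%N -> forall i, measurable (idx k @^-1` [set i]))
  (hidx_law : forall k, (1 <= k)%N -> forall i,
      Pr (idx k @^-1` [set i]) = (p i)%:E)
  (hindep : forall (n : nat) (A : nat -> set T) (B : nat -> set 'I_b),
      (forall k, measurable (A k)) ->
      Pr (\bigcap_(k in [set k | (1 <= k <= n)%N])
            (xi k @^-1` A k `&` idx k @^-1` B k)) =
      (\prod_(1 <= k < n.+1) (Pr (xi k @^-1` A k) * Pr (idx k @^-1` B k)))%E)
  (* stepsizes, number of iterations, starting point *)
  (gam : nat -> R) (N : nat) (hN : (1 <= N)%N)
  (hgam : forall k, (1 <= k <= N)%N -> 0 < gam k)
  (x1 : 'rV[R]_(\sum_(i < b) ni i)) (hx1 : prod_set Xs x1) :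
  forall x, prod_set Xs x ->
  (\int[Pr]_w
      ((f (sbmd_out P G gam x1 (fun k => xi k w) (fun k => idx k w) N) - f x)%:E)
   <= ((\sum_(1 <= k < N.+1) gam k)^-1 *
        (\sum_(i < b) (p i)^-1 *
            bregman (omega i) (domega i) (submxrow x1 i) (submxrow x i)
         + 2^-1 * (\sum_(1 <= k < N.+1) gam k ^+ 2) * \sum_(i < b) M i ^+ 2))%:E)%E.
Proof.
move=> x Xx; case: N hN hgam => // n _ gam0.
set it := fun k w => sbmd_iter P G gam x1 (fun k => xi k w) (fun k => idx k w) k.
have itX k w : (1 <= k <= n.+1)%N -> prod_set Xs (it k w).
  case: k => // k /andP[_ kn]; apply: (sbmd_iter_in hP) => // j /andP[j1 jk].
  by apply: gam0; rewrite j1 (leq_trans jk)// ltnW.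
have gain i := expected_block_gain_sum hXcv hnrm homega_diff homega_C1 homega_sc hP
  hGmeas hG hM Xx hp_pos hxi_meas hxi_law hidx_meas hidx_law hindep gam0 hx1 i.
pose h k i w := block_gain (g := g) (x := x) i (gam k) (it k w).
set Gam := \sum_(1 <= k < n.+2) gam k.
have Gam0 : 0 < Gam by exact: sum_nat_gt0.
have hi k i : k \in index_iota 1 n.+2 -> Pr.-integrable setT (EFin \o h k i).
  by rewrite mem_index_iota => k1; apply: (gain i).1.
have hsum k : k \in index_iota 1 n.+2 ->
    Pr.-integrable setT (EFin \o (fun w => \sum_(i < b) h k i w)) /\
    \int[Pr]_w (\sum_(i < b) h k i w) = \sum_(i < b) \int[Pr]_w h k i w.
  by move=> ks; apply: integrable_Rintegral_sum => i _; exact: hi.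
have [Hi HE] : Pr.-integrable setT
      (EFin \o (fun w => \sum_(1 <= k < n.+2) \sum_(i < b) h k i w)) /\
    \int[Pr]_w (\sum_(1 <= k < n.+2) \sum_(i < b) h k i w) =
    \sum_(1 <= k < n.+2) \int[Pr]_w (\sum_(i < b) h k i w).
  by apply: integrable_Rintegral_sum => k /hsum[].
(* The gap is replaced pointwise by a finite sum of integrable gains, to which linearity of the
   integral applies. *)
apply: (@le_trans _ _
    (\int[Pr]_w (Gam^-1 * \sum_(1 <= k < n.+2) \sum_(i < b) h k i w)%:E)%E).
  apply: le_integral_pointwise => w; rewrite lee_fin.
  apply: le_trans (subgradient_average (u := fun k => it k w) (cvx_prod_set hXcv)
    hgsub gam0 (fun k => @itX k w) Xx) _.
  rewrite le_eqVlt; apply/orP; left; apply/eqP; congr (_ * _).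
  apply: eq_bigr => k _; rewrite dotv_blocks mulr_sumr.
  by apply: eq_bigr => i _; rewrite /h /block_gain submxrowB.
rewrite -(@EFin_Rintegral _ _ _ Pr (fun w => Gam^-1 * _)); last first.
  by apply: eq_integrable (integrableZl measurableT Gam^-1 Hi).
rewrite lee_fin RintegralZl//; apply: ler_wpM2l; first by rewrite invr_ge0 ltW.
rewrite HE.
rewrite (eq_big_seq (fun k => \sum_(i < b) \int[Pr]_w h k i w)); last first.
  by move=> k /hsum[].
(* With the block index outermost, the telescoped bound applies to each block. *)
rewrite exchange_big /=.
apply: (@le_trans _ _ (\sum_(i < b) ((p i)^-1 *
    bregman (omega i) (domega i) (submxrow x1 i) (submxrow x i) +
    \sum_(1 <= k < n.+2) 2^-1 * (gam k ^+ 2 * M i ^+ 2)))).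
  by apply: ler_sum => i _; exact: (gain i).2.
rewrite big_split /= lerD2l mulr_sumr; apply: ler_sum => i _.
by rewrite -mulr_sumr -mulr_suml mulrA.
Qed.
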